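(* Let $n\ge 1$ be an integer, $R=\mathbb{Z}[\xi]$, and let $\mathcal{H}_n$ be the Hecke algebra of $S_n$ over $R$ with Jucys--Murphy elements $L_1,\dots,L_n$. For a partition $\lambda$ (including the empty partition) with $|\lambda|+\ell(\lambda)\le n$, put $$\mathcal{M}_\lambda=\sum_{\mu\vdash|\lambda|}N^{(|\lambda|)}_{\mu,\lambda}\,m_\mu(L_1,\dots,L_n),$$ where $N^{(k)}$ is the matrix over $R$ indexed by partitions of $k$ defined in the context, and $N^{(k)}_{\mu,\lambda}$ is its entry in the row labelled by $\mu$ and the column labelled by $\lambda$. Then the set $$\mathcal{B}=\{\mathcal{M}_\lambda \mid \lambda \text{ a partition with } |\lambda|+\ell(\lambda)\le n\}$$ is an $R$-basis for the centre $Z(\mathcal{H}_n)$ of $\mathcal{H}_n$.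
   Context: **Partitions and compositions.** A composition is a finite sequence $\lambda=(\lambda_1,\dots,\lambda_r)$ of positive integers; $\ell(\lambda)=r$ and $|\lambda|=\sum_i\lambda_i$. The empty composition $\emptyset$ has $\ell(\emptyset)=|\emptyset|=0$. A partition is a composition with weakly decreasing parts; $\lambda\vdash k$ means $\lambda$ is a partition with $|\lambda|=k$. **Symmetric group.** $S_n$ is generated by $S=\{s_i=(i\ i+1)\mid 1\le i\le n-1\}$, and $\ell(w)$ is the Coxeter length of $w\in S_n$. An element $w$ is increasing if $w=s_{i_1}s_{i_2}\cdots s_{i_k}$ with $1\le i_1<i_2<\cdots<i_k<n$. Its shape is the composition of $k$ obtained by cutting the sequence $i_1<\dots<i_k$ into maximal runs of consecutive integers and recording the lengths of the runs in order from left to right (e.g. $s_1s_3s_4s_6$ has shape $(1,2,1)$). An increasing element of shape $\lambda$ exists in $S_n$ if and only if $|\lambda|+\ell(\lambda)\le n$. **Hecke algebra.** $\mathcal{H}_n$ is the unital associative $R$-algebra, free as an $R$-module with basis $\{\tilde T_w\mid w\in S_n\}$, where $\tilde T_w=\tilde T_{s_{i_1}}\cdots\tilde T_{s_{i_r}}$ for a reduced expression $w=s_{i_1}\cdots s_{i_r}$, with multiplication determined for $w\in S_n$, $s\in S$ by $$\tilde T_w\tilde T_s=\begin{cases}\tilde T_{ws}+\xi\tilde T_w&\text{if }\ell(ws)<\ell(w),\\ \tilde T_{ws}&\text{otherwise.}\end{cases}$$ The inner product is the $R$-bilinear form with $\langle\tilde T_u,\tilde T_v\rangle=1$ if $vu=1$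 and $0$ otherwise. If $h$ is central in $\mathcal{H}_n$, then $\langle\tilde T_w,h\rangle$ is the coefficient of $\tilde T_w$ in $h$. The Jucys--Murphy elements are $L_1=0$ and $L_i=\sum_{1\le j\le i-1}\tilde T_{(j\ i)}$ for $2\le i\le n$; they commute pairwise, and symmetric polynomials in them lie in $Z(\mathcal{H}_n)$. **Monomial symmetric polynomials.** For a partition $\lambda=(\lambda_1,\dots,\lambda_r)$ with $r\le n$, $m_\lambda(X_1,\dots,X_n)$ is the sum of all distinct monomials of the form $X_{\sigma(1)}^{\lambda_1}\cdots X_{\sigma(r)}^{\lambda_r}$, $\sigma\in S_n$ (each with coefficient $1$), and $m_\emptyset=1$. **The matrices $M^{(k)}$ and $N^{(k)}$.** For $k\ge1$, $M^{(k)}$ is the square matrix indexed by the partitions of $k$ whose $(\lambda,\mu)$-entry is $\langle\tilde T_w,m_\mu(L_1,\dots,L_{n'})\rangle\in R$, where $n'$ is any integer with $n'\ge 2k$ and $w$ is any increasing element of shape $\lambda$ in $S_{n'}$; set $M^{(0)}=(1)$. It is known (Francis--Graham, 2006) that these entries are independent of the choice of $n'$ and $w$ and that $M^{(k)}$ is invertible over $R$. The matrix $N^{(k)}$ is the inverse of $M^{(k)}$, with entries in $R$. (Note that $N^{(k)}$ depends only on $k$, not on $n$.) *)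

(* Defs.v *)
From HB Require Import structures.
From mathcomp Require Import all_boot all_order all_algebra all_fingroup.
From mathcomp Require Import zify.
From mathcomp Require Import mpoly.

Set Implicit Arguments.
Unset Strict Implicit.
Unset Printing Implicit Defensive.

Import GRing.Theory.

Local Open Scope ring_scope.

Definition is_partition (la : seq nat) := sorted geq la && (0%N \notin la).

Record intpartn (k : nat) := IntPartn {
  pparts :> seq nat;
  intpartnP : is_partition pparts && (sumn pparts == k) }.

HB.instance Definition _ k := [isSub for @pparts k].
HB.instance Definition _ k := [Countable of intpartn k by <:].

Section IntPartnFinite.
Variable k : nat.

Let candidates : seq (seq nat) :=
  [seq map val (tval t) | r <- iota 0 k.+1, t <- enum {: r.-tuple 'I_k.+1}].

Let enumP : seq (intpartn k) := undup (pmap insub candidates).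

Lemma partition_bounds (la : intpartn k) :
  (size la <= k)%N /\ all (leq^~ k) la.
Proof.
case: la => la /= /andP[/andP[_ la0] /eqP <-]; elim: la la0 => //= a la IH.
rewrite inE negb_or => /andP[a0 /IH [sz al]]; split; first by lia.
by rewrite leq_addr /=; apply: sub_all al => x; lia.
Qed.

Lemma mem_candidates (la : intpartn k) : val la \in candidates.
Proof.
have [sz al] := partition_bounds la.
apply/allpairsPdep.
have szt : size (map (@inord k) la) == size la by rewrite size_map.
exists (size la), (Tuple szt); split => /=.
- by rewrite -[X in is_true X]/(size la \in iota 0 k.+1) mem_iota add0n ltnS.
- by rewrite mem_enum.
rewrite -map_comp -[LHS]map_id; apply/eq_in_map => x xla /=.
by rewrite inordK // ltnS (allP al).
Qed.

Lemma intpartn_enumP : Finite.axiom enumP.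
Proof.
apply: Finite.uniq_enumP; first exact: undup_uniq.
move=> la; rewrite mem_undup mem_pmap_sub; exact: mem_candidates.
Qed.

HB.instance Definition _ := isFinite.Build (intpartn k) intpartn_enumP.
End IntPartnFinite.

Lemma sref_subproof n (i : 'I_n.-1) : (i.+1 < n)%N.
Proof. by rewrite -ltn_predRL. Qed.

Definition sleft n (i : 'I_n.-1) : 'I_n := widen_ord (leq_pred n) i.
Definition sright n (i : 'I_n.-1) : 'I_n := Ordinal (sref_subproof i).

(* Points of 'I_n and generators are numbered from 0: [sref i] is the
   transposition usually written s_(i+1).  MathComp composes permutations from
   left to right; this is immaterial here, inversion being an isomorphism
   between the two conventions that fixes the generators and the transpositions. *)
Definition sref n (i : 'I_n.-1) : 'S_n := tperm (sleft i) (sright i).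

Definition wprod n (t : seq 'I_n.-1) : 'S_n := (\prod_(i <- t) sref i)%g.

Section Length.
Variable n : nat.
Implicit Types (w v : 'S_n) (i j : 'I_n.-1) (t : seq 'I_n.-1).

Lemma sref2 i : (sref i * sref i = 1)%g.
Proof. exact: tperm2. Qed.

Lemma srefK i w : (sref i * (sref i * w) = w)%g.
Proof. by rewrite mulgA sref2 mul1g. Qed.

Lemma srefKr i w : (w * sref i * sref i = w)%g.
Proof. by rewrite -mulgA sref2 mulg1. Qed.

Let invset w :=
  [set p : 'I_n * 'I_n | (p.1 < p.2)%N && (w p.2 < w p.1)%N].
Let ninv w := #|invset w|.

Lemma sref_lt i (x y : 'I_n) : (x, y) != (sleft i, sright i) ->
  (x, y) != (sright i, sleft i) -> (sref i x < sref i y)%N = (x < y)%N.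
Proof.
rewrite !xpair_eqE -!val_eqE /= /sref.
case: tpermP => [->|->|/eqP + /eqP +]; case: tpermP => [->|->|/eqP + /eqP +];
  rewrite -?val_eqE /=; lia.
Qed.

Lemma ninv_up i w :
  (w (sleft i) < w (sright i))%N -> ninv (sref i * w)%g = (ninv w).+1.
Proof.
move=> lt_w; set a := sleft i; set b := sright i.
pose f (p : 'I_n * 'I_n) := (sref i p.1, sref i p.2).
have fI : injective f.
  by move=> [x y] [z t] [/perm_inj -> /perm_inj ->].
have sa : sref i a = b by rewrite /sref tpermL.
have sb : sref i b = a by rewrite /sref tpermR.
have -> : ninv (sref i * w)%g = #|(a, b) |: (f @^-1: invset w)|.
  apply: eq_card => -[x y]; rewrite !inE /= !permM.
  have [/eqP[-> ->]|ne1] /= := boolP ((x, y) == (a, b)).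
    by rewrite sa sb lt_w andbT /a /b /= ltnSn.
  have [/eqP[-> ->]|ne2] /= := boolP ((x, y) == (b, a)).
    by rewrite sa sb /a /b /=; lia.
  by rewrite sref_lt.
rewrite cardsU1 !inE /= sa sb /= ltnNge leqW //= add1n.
congr _.+1; rewrite on_card_preimset //.
exists f => -[x y] _ /=; rewrite /f /=.
  by rewrite -!permM !sref2 !perm1.
by rewrite -!permM !sref2 !perm1.
Qed.

Lemma sref_cmp i w :
  (w (sright i) < w (sleft i))%N = ~~ (w (sleft i) < w (sright i))%N.
Proof.
rewrite -leqNgt [RHS]leq_eqVlt; case: eqP => //= /ord_inj /perm_inj /(congr1 val) /=.
lia.
Qed.

Lemma ninv_down i w :
  (w (sright i) < w (sleft i))%N -> ninv w = (ninv (sref i * w)%g).+1.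
Proof.
move=> lt_w; rewrite -[in LHS](srefK i w) ninv_up //.
by rewrite !permM /sref tpermL tpermR.
Qed.

Lemma ninv_le i w : (ninv (sref i * w)%g <= (ninv w).+1)%N.
Proof.
have [lt_w|] := boolP (w (sleft i) < w (sright i))%N; first by rewrite ninv_up.
by rewrite -sref_cmp => /ninv_down ->; rewrite ltnW // ltnW.
Qed.

Lemma no_descent w :
  (forall i, (w (sleft i) < w (sright i))%N) -> w = 1%g.
Proof.
move=> asc.
have mono (x y : 'I_n) : (x < y)%N -> (w x < w y)%N.
  case: x y => x hx [y hy] /= lt_xy; elim: y hy lt_xy => // y IH hy.
  have hy' : (y < n)%N by apply: ltnW.
  have hi : (y < n.-1)%N by rewrite ltn_predRL.
  have step : (w (Ordinal hy') < w (Ordinal hy))%N.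
    have := asc (Ordinal hi).
    have -> : sleft (Ordinal hi) = Ordinal hy' by apply: val_inj.
    by have -> : sright (Ordinal hi) = Ordinal hy by apply: val_inj.
  rewrite ltnS leq_eqVlt => /orP[/eqP Exy|/(IH hy')]; last first.
    by move/ltn_trans; apply.
  by have -> : Ordinal hx = Ordinal hy' by apply: val_inj.
have monoV (x y : 'I_n) : (x < y)%N -> ((w^-1)%g x < (w^-1)%g y)%N.
  move=> lt_xy; rewrite ltnNge leq_eqVlt; apply/negP => /orP[/eqP|/mono].
    by move/ord_inj/perm_inj => E; rewrite E ltnn in lt_xy.
  by rewrite !permKV; lia.
have ge (v : 'S_n) : (forall x y : 'I_n, (x < y)%N -> (v x < v y)%N) ->
    forall x : 'I_n, (x <= v x)%N.
  move=> mv [x hx] /=; elim: x hx => // x IH hx.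
  have hx' : (x < n)%N by apply: ltnW.
  by apply: leq_ltn_trans (IH hx') (mv _ _ _).
apply/permP => x; rewrite perm1; apply: val_inj; apply/eqP.
rewrite eqn_leq ge // andbT.
by have := ge _ monoV (w x); rewrite permK.
Qed.

Lemma wprod_cons i t : wprod (i :: t) = (sref i * wprod t)%g.
Proof. by rewrite /wprod big_cons. Qed.

Lemma wprod_rcons i t : wprod (rcons t i) = (wprod t * sref i)%g.
Proof. by rewrite /wprod -cats1 big_cat big_seq1. Qed.

Lemma wprod_rev t : wprod (rev t) = ((wprod t)^-1)%g.
Proof.
elim: t => [|i t IH]; first by rewrite /wprod !big_nil invg1.
by rewrite rev_cons wprod_rcons wprod_cons invMg IH /sref tpermV.
Qed.

Lemma ninv1 : ninv 1%g = 0%N.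
Proof.
by apply: eq_card0 => -[x y]; rewrite !inE !perm1 /= ltnNge andbC;
  case: ltnP => //= /ltnW ->.
Qed.

Lemma ninv_word t : (ninv (wprod t) <= size t)%N.
Proof.
elim: t => [|i t IH]; first by rewrite /wprod big_nil ninv1.
by rewrite wprod_cons (leq_trans (ninv_le _ _)).
Qed.

Lemma descentP w : w != 1%g -> exists i, (w (sright i) < w (sleft i))%N.
Proof.
move=> w1; apply/existsP; apply: contraR w1 => /existsPn nd.
by apply/eqP/no_descent => i; have := nd i; rewrite sref_cmp negbK.
Qed.

Lemma ninv_exists w : exists2 t, wprod t = w & size t = ninv w.
Proof.
move: {2}(ninv w) (leqnn (ninv w)) => m; elim: m w => [|m IH] w le_m.
  have [->|/descentP[i /ninv_down]] := eqVneq w 1%g; last by lia.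
  by exists [::]; rewrite ?ninv1 // /wprod big_nil.
have [->|/descentP[i /ninv_down E]] := eqVneq w 1%g.
  by exists [::]; rewrite ?ninv1 // /wprod big_nil.
have [|t Et St] := IH (sref i * w)%g; first by lia.
by exists (i :: t); rewrite ?wprod_cons ?Et ?srefK //= St E.
Qed.

Lemma word_exists w : exists r, [exists t : r.-tuple 'I_n.-1, wprod t == w].
Proof.
have [t Et _] := ninv_exists w.
by exists (size t); apply/existsP; exists (in_tuple t); apply/eqP.
Qed.

Definition coxlen w : nat := ex_minn (word_exists w).

Lemma redword_exists w : exists t : (coxlen w).-tuple 'I_n.-1, wprod t == w.
Proof. by rewrite /coxlen; case: ex_minnP => r /existsP. Qed.

Definition redword w : seq 'I_n.-1 := tval (xchoose (redword_exists w)).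

Lemma redwordK w : wprod (redword w) = w.
Proof. exact/eqP/(xchooseP (redword_exists w)). Qed.

Lemma size_redword w : size (redword w) = coxlen w.
Proof. exact: size_tuple. Qed.

Lemma coxlen_word t : (coxlen (wprod t) <= size t)%N.
Proof.
rewrite /coxlen; case: ex_minnP => r _; apply.
by apply/existsP; exists (in_tuple t).
Qed.

Lemma coxlenE w : coxlen w = ninv w.
Proof.
apply/eqP; rewrite eqn_leq; apply/andP; split.
  by have [t <- <-] := ninv_exists w; apply: coxlen_word.
by rewrite -{1}(redwordK w) -(size_redword w) ninv_word.
Qed.

Lemma coxlenV w : coxlen (w^-1)%g = coxlen w.
Proof.
have le v : (coxlen (v^-1)%g <= coxlen v)%N.
  by rewrite -{1}(redwordK v) -wprod_rev -(size_redword v) -size_rev coxlen_word.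
by apply/eqP; rewrite eqn_leq le -{1}(invgK w) le.
Qed.

Lemma coxlen1 : coxlen 1%g = 0%N.
Proof. by rewrite coxlenE ninv1. Qed.

Definition dl i w := (coxlen (sref i * w)%g < coxlen w)%N.
Definition dr i w := (coxlen (w * sref i)%g < coxlen w)%N.

Lemma dlE i w : dl i w = (w (sright i) < w (sleft i))%N.
Proof.
rewrite /dl !coxlenE.
have [/ninv_down ->|] := boolP (w (sright i) < w (sleft i))%N.
  by rewrite ltnSn.
by rewrite sref_cmp negbK => /ninv_up ->; apply/negbTE; rewrite -leqNgt ltnW.
Qed.

Lemma drV i w : dr i w = dl i (w^-1)%g.
Proof.
by rewrite /dl -[(sref i * _)%g]invgK invMg invgK /sref tpermV !coxlenV.
Qed.

Lemma drE i w : dr i w = ((w^-1)%g (sright i) < (w^-1)%g (sleft i))%N.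
Proof. by rewrite drV dlE. Qed.

Lemma coxlen_up i w : ~~ dr i w -> coxlen (w * sref i)%g = (coxlen w).+1.
Proof.
rewrite drE sref_cmp negbK => /ninv_up E.
have -> : coxlen (w * sref i)%g = coxlen (sref i * w^-1)%g.
  by rewrite -[in LHS]coxlenV invMg /sref tpermV.
by rewrite -(coxlenV w) !coxlenE E.
Qed.

Lemma coxlen_le_rcons i w : (coxlen (w * sref i)%g <= (coxlen w).+1)%N.
Proof.
have [|/coxlen_up -> //] := boolP (dr i w).
by rewrite /dr => /ltnW/leqW.
Qed.

Lemma dl_mulr i j w : (sref i * w != w * sref j)%g ->
  dl i (w * sref j)%g = dl i w.
Proof.
move=> ne; rewrite !dlE !permM.
have key (c : bool) : (w (sleft i), w (sright i)) !=
    (if c then (sleft j, sright j) else (sright j, sleft j)).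
  apply: contraNneq ne => E; apply/eqP.
  have -> : (sref i * w = w * tperm (w (sleft i)) (w (sright i)))%g.
    by rewrite -tpermJ /conjg !mulgA mulgV mul1g.
  by case: c E => -[-> ->] //; rewrite tpermC.
rewrite sref_lt //.
  by have := key false; apply: contraNneq => -[-> ->].
by have := key true; apply: contraNneq => -[-> ->].
Qed.

Lemma dr_mull i j w : (sref i * w != w * sref j)%g ->
  dr j (sref i * w)%g = dr j w.
Proof.
move=> ne; rewrite !drV invMg /sref tpermV -!/(sref _) dl_mulr //.
apply: contraNneq ne => E; apply/eqP; apply: invg_inj.
by rewrite !invMg /sref !tpermV -!/(sref _) E.
Qed.

Lemma dr_flip j w : dr j (w * sref j)%g = ~~ dr j w.
Proof.
have [|/coxlen_up E] := boolP (dr j w); rewrite /dr srefKr; first lia.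
by rewrite E; lia.
Qed.

Lemma dl_flip j w : dl j (sref j * w)%g = ~~ dl j w.
Proof. by rewrite !dlE !permM /sref tpermL tpermR sref_cmp negbK. Qed.

End Length.

Notation Zxi := {poly int}.
Notation xi := ('X : {poly int}).

(* The free Zxi-module on 'S_n; this alias carries the Hecke product below
   and not the pointwise product of functions. *)
Definition hecke (n : nat) := {ffun 'S_n -> Zxi}.

HB.instance Definition _ n :=
  GRing.Lmodule.copy (hecke n) {ffun 'S_n -> Zxi^o}.

Definition heckeT n (w : 'S_n) : hecke n := [ffun v => (v == w)%:R].

Section HeckeProduct.
Variable n : nat.
Implicit Types (w v : 'S_n) (i j : 'I_n.-1) (a b c : hecke n).
Local Notation T := (@heckeT n).

Definition lext (f : 'S_n -> hecke n) a : hecke n := \sum_w a w *: f w.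

(* Right multiplication by T_s is prescribed; T_w acts on the right through a
   chosen reduced word of w.  The resulting product is associative and satisfies
   the defining rules of the Hecke algebra: see [heckeT_mulS] and
   [heckeT_reduced], and [hecke_sum] for the basis. *)
Definition rmulS i : hecke n -> hecke n :=
  lext (fun w => if (coxlen (w * sref i)%g < coxlen w)%N
                 then T (w * sref i)%g + xi *: T w else T (w * sref i)%g).

Definition rmul_word (t : seq 'I_n.-1) a : hecke n :=
  foldl (fun x i => rmulS i x) a t.

Definition hecke_one : hecke n := T 1%g.

Definition hecke_mul a b : hecke n :=
  \sum_w b w *: rmul_word (redword w) a.

Lemma lext_linear f : linear (lext f).
Proof.
move=> k a b; rewrite /lext scaler_sumr -big_split; apply: eq_bigr => w _ /=.
by rewrite !ffunE scalerDl scalerA.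
Qed.

Lemma lextT f w : lext f (T w) = f w.
Proof.
rewrite /lext (bigD1 w) //= ffunE eqxx scale1r big1 ?addr0 // => v /negbTE ne.
by rewrite ffunE ne scale0r.
Qed.

Lemma hecke_sum a : a = \sum_w a w *: T w.
Proof.
apply/ffunP => v; rewrite sum_ffunE (bigD1 v) //= !ffunE eqxx.
rewrite big1 => [|w ne]; first by rewrite addr0 -[RHS]/(_ * _) mulr1.
by rewrite !ffunE eq_sym (negbTE ne) -[LHS]/(_ * _) mulr0.
Qed.

Lemma lin_sum (f : hecke n -> hecke n) : linear f ->
  forall a, f a = \sum_w a w *: f (T w).
Proof.
move=> lf a; pose m := GRing.isLinear.Build _ _ _ _ f lf.
pose F : {linear hecke n -> hecke n} := HB.pack f m.
rewrite -[f]/(F : _ -> _) {1}(hecke_sum a) linear_sum.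
by apply: eq_bigr => w _; rewrite linearZ.
Qed.

Lemma rmulS_linear i : linear (rmulS i).
Proof. exact: lext_linear. Qed.

Lemma rmul_word_linear t : linear (rmul_word t).
Proof.
elim: t => [|i t IH] k a b //=.
by rewrite /rmul_word /= rmulS_linear -/(rmul_word t _) IH.
Qed.

Lemma hecke_mul_linearl b : linear (hecke_mul^~ b).
Proof.
move=> k a c; rewrite /hecke_mul scaler_sumr -big_split; apply: eq_bigr => w _.
by rewrite /= rmul_word_linear scalerDr !scalerA [k * _]mulrC.
Qed.

Lemma hecke_mul_linearr a : linear (hecke_mul a).
Proof. exact: (lext_linear (fun w => rmul_word (redword w) a)). Qed.

Lemma rmulST i w :
  rmulS i (T w) = T (w * sref i)%g + (xi *+ dr i w) *: T w.
Proof.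
rewrite /rmulS lextT -/(dr i w); case: (dr i w); first by rewrite mulr1n.
by rewrite mulr0n scale0r addr0.
Qed.

Definition lmulS i : hecke n -> hecke n :=
  lext (fun w => T (sref i * w)%g + (xi *+ dl i w) *: T w).

Let lmulST i w :
  lmulS i (T w) = T (sref i * w)%g + (xi *+ dl i w) *: T w.
Proof. exact: lextT. Qed.

Let lmulS_linear i : linear (lmulS i).
Proof. exact: lext_linear. Qed.

Let linD (f : hecke n -> hecke n) : linear f -> forall k a b,
  f (a + k *: b) = f a + k *: f b.
Proof. by move=> lf k a b; rewrite addrC lf addrC. Qed.

Let scale_exchange (R : comPzRingType) (V : lmodType R) (k l : R) (A B C D : V) :
  A + l *: B + k *: (C + l *: D) = A + k *: C + l *: (B + k *: D).
Proof. by rewrite !scalerDr !scalerA (mulrC k l) -!addrA; congr (_ + _); exact: addrCA. Qed.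

Let lrmulST i j w : lmulS i (rmulS j (T w)) = rmulS j (lmulS i (T w)).
Proof.
rewrite rmulST lmulST (linD (lmulS_linear i)) (linD (rmulS_linear j)).
rewrite (lmulST i (w * sref j)%g) (rmulST j (sref i * w)%g) lmulST rmulST.
rewrite mulgA.
have [E|ne] := eqVneq (sref i * w)%g (w * sref j)%g.
  have Ed : dl i w = dr j w by rewrite /dl /dr E.
  have Edl : dl i (w * sref j)%g = ~~ dl i w by rewrite -E dl_flip.
  have Edr : dr j (sref i * w)%g = ~~ dr j w by rewrite E dr_flip.
  by rewrite Edl Edr E Ed.
rewrite (dl_mulr ne) (dr_mull ne).
exact: scale_exchange.
Qed.

Let lcomm (f : hecke n -> hecke n) :=
  linear f /\ forall i a, f (lmulS i a) = lmulS i (f a).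

Let lcomm_comp f g : lcomm f -> lcomm g -> lcomm (f \o g).
Proof.
move=> [lf cf] [lg cg]; split => [k a b|i a] /=; first by rewrite lg lf.
by rewrite cg cf.
Qed.

Let lcomm_rmulS j : lcomm (rmulS j).
Proof.
split=> [|i a]; first exact: rmulS_linear.
have l1 : linear (rmulS j \o lmulS i).
  by move=> k b c /=; rewrite lmulS_linear rmulS_linear.
have l2 : linear (lmulS i \o rmulS j).
  by move=> k b c /=; rewrite rmulS_linear lmulS_linear.
rewrite -[LHS]/((rmulS j \o lmulS i) a) -[RHS]/((lmulS i \o rmulS j) a).
rewrite (lin_sum l1) (lin_sum l2); apply: eq_bigr => w _ /=.
by rewrite lrmulST.
Qed.

Let lcomm_word t : lcomm (rmul_word t).
Proof.
elim: t => [|i t IH]; first by split.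
exact: (lcomm_comp IH (lcomm_rmulS i)).
Qed.

Let lcomm_mul b : lcomm (hecke_mul^~ b).
Proof.
split=> [|i a]; first exact: hecke_mul_linearl.
pose F : {linear hecke n -> hecke n} :=
  HB.pack (lmulS i) (GRing.isLinear.Build _ _ _ _ (lmulS i) (lmulS_linear i)).
rewrite -[RHS]/(F _) linear_sum; apply: eq_bigr => w _.
by rewrite linearZ /= (lcomm_word _).2.
Qed.

Let lcomm_eq f g : lcomm f -> lcomm g -> f (T 1%g) = g (T 1%g) -> f =1 g.
Proof.
move=> [lf cf] [lg cg] E1 a; rewrite (lin_sum lf) (lin_sum lg).
apply: eq_bigr => w _; congr (_ *: _).
move: {2}(coxlen w) (leqnn (coxlen w)) => m; elim: m w => [|m IH] w le_m.
  have [->//|/descentP[i]] := eqVneq w 1%g.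
  by rewrite -dlE /dl; lia.
have [->//|/descentP[i]] := eqVneq w 1%g; rewrite -dlE => di.
have Ew : T w = lmulS i (T (sref i * w)%g).
  by rewrite lmulST srefK dl_flip di mulr0n scale0r addr0.
rewrite Ew cf cg; congr lmulS; apply: IH.
by move: di; rewrite /dl; lia.
Qed.

Lemma rmul_word_reduced t : coxlen (wprod t) = size t ->
  rmul_word t (T 1%g) = T (wprod t).
Proof.
elim/last_ind: t => [|t i IH]; first by rewrite /wprod big_nil.
rewrite wprod_rcons size_rcons => E.
have Et : coxlen (wprod t) = size t.
  have := coxlen_word t; have := coxlen_le_rcons i (wprod t); lia.
rewrite /rmul_word -cats1 foldl_cat /= -/(rmul_word t _) IH // rmulST.
have -> : dr i (wprod t) = false by rewrite /dr E Et; lia.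
by rewrite mulr0n scale0r addr0.
Qed.

Lemma hecke_mul1l : left_id hecke_one hecke_mul.
Proof.
move=> b; rewrite /hecke_mul [RHS]hecke_sum; apply: eq_bigr => w _.
by rewrite rmul_word_reduced redwordK // size_redword.
Qed.

Lemma hecke_mul1r : right_id hecke_one hecke_mul.
Proof.
move=> a; apply: (lcomm_eq (lcomm_mul hecke_one) (g := id)) => //.
exact: hecke_mul1l.
Qed.

Lemma hecke_mulA : associative hecke_mul.
Proof.
move=> a b c.
apply: (lcomm_eq (lcomm_mul (hecke_mul b c))
                 (lcomm_comp (lcomm_mul c) (lcomm_mul b))) => /=.
by rewrite !hecke_mul1l.
Qed.

Lemma hecke_mulDl : left_distributive hecke_mul +%R.
Proof.
by move=> a b c; rewrite -{1}(scale1r a) hecke_mul_linearl scale1r.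
Qed.

Lemma hecke_mulDr : right_distributive hecke_mul +%R.
Proof.
by move=> a b c; rewrite -{1}(scale1r b) hecke_mul_linearr scale1r.
Qed.

Lemma hecke_one_neq0 : hecke_one != 0.
Proof.
apply/eqP => /ffunP/(_ 1%g); rewrite !ffunE eqxx => /eqP.
by rewrite oner_eq0.
Qed.

End HeckeProduct.

HB.instance Definition _ n := GRing.Zmodule_isNzRing.Build (hecke n)
  (@hecke_mulA n) (@hecke_mul1l n) (@hecke_mul1r n)
  (@hecke_mulDl n) (@hecke_mulDr n) (@hecke_one_neq0 n).

Section HeckeAlgebra.
Variable n : nat.
Implicit Types (a b : hecke n) (w : 'S_n) (i : 'I_n.-1).
Local Notation T := (@heckeT n).

Lemma hecke_scaleAl (k : Zxi) a b : k *: (a * b) = (k *: a) * b.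
Proof.
have := hecke_mul_linearl b k a 0; rewrite addr0 => E.
rewrite -[RHS]/(hecke_mul _ b) E.
by rewrite -[hecke_mul 0 b]/(0 * b) mul0r addr0.
Qed.

HB.instance Definition _ :=
  GRing.Lmodule_isLalgebra.Build Zxi (hecke n) hecke_scaleAl.

Lemma hecke_scaleAr (k : Zxi) a b : k *: (a * b) = a * (k *: b).
Proof.
have := hecke_mul_linearr a k b 0; rewrite addr0 => E.
rewrite -[RHS]/(hecke_mul a _) E.
by rewrite -[hecke_mul a 0]/(a * 0) mulr0 addr0.
Qed.

HB.instance Definition _ :=
  GRing.Lalgebra_isAlgebra.Build Zxi (hecke n) hecke_scaleAr.

Lemma heckeT1 : T 1%g = 1.
Proof. by []. Qed.

Lemma hecke_mulS a i : a * T (sref i) = rmulS i a.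
Proof.
rewrite -[a * _]/(lext (fun w => rmul_word (redword w) a) _) lextT.
have sz : size (redword (sref i)) = 1%N.
  have := coxlen_word [:: i]; rewrite /= wprod_cons /wprod big_nil mulg1.
  rewrite size_redword; case E: (coxlen _) => [|[|m]] // _.
  have := redwordK (sref i); have := size_redword (sref i); rewrite E.
  case: (redword _) => //= _; rewrite /wprod big_nil => /permP/(_ (sleft i)).
  by rewrite perm1 /sref tpermL => /(congr1 val) /=; lia.
have := redwordK (sref i); case: (redword _) sz => [|j [|? ?]] // _.
rewrite /wprod big_seq1 => /permP Ej; rewrite /rmul_word /=.
suff -> : j = i by [].
apply: val_inj; move: (Ej (sleft j)) (Ej (sright j)).
rewrite /sref tpermL tpermR.
case: tpermP => [/(congr1 val) /= e1|/(congr1 val) /= e1|_ _] /(congr1 val) /= e2;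
  case: tpermP => [/(congr1 val) /= e3|/(congr1 val) /= e3|_ _] /(congr1 val) /=;
  lia.
Qed.

Lemma heckeT_mulS w i :
  T w * T (sref i) = if (coxlen (w * sref i)%g < coxlen w)%N
                     then T (w * sref i)%g + xi *: T w
                     else T (w * sref i)%g.
Proof. by rewrite hecke_mulS /rmulS lextT. Qed.

Lemma heckeT_reduced (t : seq 'I_n.-1) : coxlen (wprod t) = size t ->
  T (wprod t) = \prod_(i <- t) T (sref i).
Proof.
move/rmul_word_reduced <-; rewrite heckeT1.
elim/last_ind: t => [|t i IH]; first by rewrite big_nil.
by rewrite /rmul_word -!cats1 foldl_cat big_cat big_seq1 /= -IH hecke_mulS.
Qed.

End HeckeAlgebra.

Definition hecke_form n (a b : hecke n) : Zxi :=
  \sum_u \sum_v a u * b v * ((v * u)%g == 1%g)%:R.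

Definition jucys_murphy n (i : 'I_n) : hecke n :=
  \sum_(j < n | (j < i)%N) heckeT (tperm j i).

(* The s-th monomial is X_(s 0)^la_0 X_(s 1)^la_1 ..., so X_i has exponent
   la_(s^-1 i).  Only meant for [size la <= n]. *)
Definition monomial_sym n (la : seq nat) : {mpoly Zxi[n]} :=
  \sum_(m <- undup [seq [multinom nth 0%N la ((s^-1)%g i) | i < n] | s : 'S_n])
    'X_[m].

Definition monomial_jm n (la : seq nat) : hecke n :=
  mmap (in_alg (hecke n)) (@jucys_murphy n) (monomial_sym n la).

(* Lengths of the maximal runs i, i+1, i+2, ... in s. *)
Fixpoint run_lengths (s : seq nat) : seq nat :=
  if s is i :: s' then
    if ohead s' == Some i.+1 then incr_nth (run_lengths s') 0
    else 1%N :: run_lengths s'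
  else [::].

Definition increasing_of_shape n (la : seq nat) (w : 'S_n) :=
  exists t : seq 'I_n.-1,
    [/\ sorted ltn (map val t), w = wprod t & run_lengths (map val t) = la].

Definition matM k n (w : intpartn k -> 'S_n) : 'M[Zxi]_#|{: intpartn k}| :=
  \matrix_(i, j)
    if k == 0%N then (i == j)%:R
    else hecke_form (heckeT (w (enum_val i)))
                    (monomial_jm n (enum_val j : intpartn k)).

Definition matN k n (w : intpartn k -> 'S_n) (mu la : intpartn k) : Zxi :=
  invmx (matM w) (enum_rank mu) (enum_rank la).

Definition calM n k (N : intpartn k -> intpartn k -> Zxi) (la : intpartn k) :
    hecke n :=
  \sum_(mu : intpartn k) N mu la *: monomial_jm n mu.

(* Partitions la with |la| + l(la) <= n: the pairs of k = |la| (necessarily at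
   most n) and a partition of k. *)
Definition admissible n :=
  {la : {k : 'I_n.+1 & intpartn k} | (tag la + size (tagged la) <= n)%N}.

Definition hecke_centre n (z : hecke n) := forall h : hecke n, z * h = h * z.

(* The family b is a basis of the submodule Z; in particular it is injective,
   so this is the same as its image being a basis. *)
Definition is_basis_of (R : nzRingType) (V : lmodType R) (Z : V -> Prop)
    (I : finType) (b : I -> V) :=
  [/\ forall i, Z (b i),
      forall v, Z v -> exists c : I -> R, v = \sum_i c i *: b i
    & forall c : I -> R, \sum_i c i *: b i = 0 -> forall i, c i = 0].

(* Main.v *)
(* Let tau be the trace that reads off the coefficient of 1.  A polynomial in
   the Jucys-Murphy elements is paired with an increasing element one strand at
   a time, from the last strand down, by the conditional expectations of L_m^a
   and L_(m+1)^a t_m onto the smaller algebras.  Only leading degrees matter: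
   the pairing of the sum of the Q(s) L^s, |s| = k, with an increasing element
   is zero if the element is longer than k, and if it has length k it is a
   combinatorial functional of the coefficient function Q.
   For functions Q invariant under insertion of zeros (quasi-symmetric
   functions) these functionals are triangular enough to span all evaluations
   Q |-> Q(s).  For symmetric Q they depend only on the shape, because tau is a
   trace and increasing elements of the same shape are conjugate by an invertible
   element; so M^(k) is invertible.  Hence pairing the M_la with one increasing
   element of each shape gives a block unitriangular matrix.  These pairings
   separate the centre, as increasing elements span the Hecke algebra modulo
   commutators. *)

Require Import Defs.
From HB Require Import structures.
From mathcomp Require Import all_boot all_order all_algebra all_fingroup.
From mathcomp Require Import mpoly zify.

Set Implicit Arguments.
Unset Strict Implicit.
Unset Printing Implicit Defensive.

Import GRing.Theory.

Local Open Scope ring_scope.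

(** * Values of coefficient functions *)

(** The matrix N^(k) is given only as an inverse, so M^(k) needs a formula for its entries that does
    not mention n. The formula exists because integrating out a strand costs degree: the
    expectations of L^c with c > 0 and of L^c t have degree at most c - 1 in the remaining
    Jucys-Murphy elements. An increasing element of length k therefore uses up degree k exactly: a
    strand not linked to its predecessor must carry exponent 0, and on a linked strand only the
    leading part of the expectation counts. Strands outside the nontrivial blocks thus become
    invisible, and the entries computed in S_n' with n' >= 2k are also the pairings in H_n when n <
    2k.

    The leading parts are governed by the series kappa(u) = (1-u)^2 / ((1-u)^2 - xi^2 u), with one
    factor kappa(L_i u) for each remaining strand. Its constant term is 1, which is why the
    triangular systems can be solved over Z[xi] itself and not only over its fraction field. *)

Section SpannedFunctionals.
Variables (R : comNzRingType) (X : Type) (ok : X -> Prop).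
Variables (I : Type) (good : pred I) (e : I -> X -> R).
Implicit Types F : X -> R.

Definition spanned F :=
  exists2 l : seq (R * I), all (fun p => good p.2) l &
    forall x, ok x -> F x = \sum_(p <- l) p.1 * e p.2 x.

Lemma eq_spanned F F' :
  (forall x, ok x -> F x = F' x) -> spanned F -> spanned F'.
Proof. by move=> EF [l al E]; exists l => // S zS; rewrite -EF // E. Qed.

Lemma spanned_sub_sum (J : eqType) (r : seq J) (a : J -> R) F0 (F : J -> X -> R) :
  (forall j, j \in r -> spanned (F j)) -> spanned F0 ->
  spanned (fun x => F0 x - \sum_(j <- r) a j * F j x).
Proof.
move=> sF [l0 al0 E0]; elim: r sF => [|j r IH] sF.
  by exists l0 => // x /E0 ->; rewrite big_nil subr0.
have [i ir|l al E] := IH; first by apply: sF; rewrite inE ir orbT.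
have [l' al' E'] := sF j (mem_head _ _).
exists ([seq (- a j * p.1, p.2) | p <- l'] ++ l).
  by rewrite all_cat al andbT all_map.
move=> x okx; rewrite big_cons big_cat big_map /= -E // E' // opprD addrCA.
rewrite mulr_sumr -sumrN; congr (_ + _).
by apply: eq_bigr => p _; rewrite !mulNr mulrA.
Qed.

End SpannedFunctionals.

Section CoefficientFunctions.
Variables (R : comNzRingType) (xi : R).
Implicit Types (Q : seq nat -> R) (S Phi : nat -> seq nat -> R).
Implicit Types (s u v c : seq nat).

(* Leading coefficients of the recursion exp_step below. *)
Fixpoint theta_rho (g : nat) : R * R :=
  if g is g'.+1 then
    let: (th, rh) := theta_rho g' in (th + rh, rh + xi ^+ 2 * (th + rh))
  else (0, 1).

Definition theta g := (theta_rho g).1.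
Definition rho g := (theta_rho g).2.
(** As power series theta = u rho / (1-u) and rho = kappa / (1-u), whence kappa = (1-u)^2 / ((1-u)^2
    - xi^2 u). The series theta describes the leading part of [exp_diff], and rho that of
    [exp_jm_gen]. *)
Definition kappa g : R := (g == 0%N)%:R + xi ^+ 2 * theta g.

Lemma theta0 : theta 0 = 0. Proof. by []. Qed.
Lemma rho0 : rho 0 = 1. Proof. by []. Qed.

Lemma thetaS g : theta g.+1 = theta g + rho g.
Proof. by rewrite /theta /rho /=; case: theta_rho. Qed.

Lemma rhoS g : rho g.+1 = rho g + xi ^+ 2 * theta g.+1.
Proof. by rewrite /theta /rho /=; case: theta_rho. Qed.

Lemma kappa0 : kappa 0 = 1.
Proof. by rewrite /kappa theta0 mulr0 addr0. Qed.

(** The effect on coefficient functions of multiplying by the product of the series kappa(L_i u)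
    over all strands: each strand keeps a - g of its exponent and g is charged to b. See
    [jm_eval_kmul]. *)
Fixpoint kmul Phi (b : nat) s : R :=
  if s is a :: s' then
    \sum_(g < a.+1) kappa g * kmul (fun d u => Phi d ((a - g)%N :: u)) (b + g) s'
  else Phi b [::].

(* The head of an exponent sequence belongs to the last strand.  A state S has
   an extra argument b, the exponent received from the strands already
   eliminated from the current block. *)
Definition top_state Q : nat -> seq nat -> R :=
  kmul (fun d s => Q (d.+1 :: s)).

(** The exponent i received by the next strand and its own exponent add up to d + 1. The shift is
    the degree consumed by linking this strand to its predecessor. *)
Definition merge_state S : nat -> seq nat -> R :=
  fun d s => \sum_(i < d.+2) S i ((d.+1 - i)%N :: s).

Definition next_state S := kmul (merge_state S).

Definition block_step (r : nat) Q : seq nat -> R :=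
  if r is r'.+1 then iter r' next_state (top_state Q) 0%N else Q.

(* Here c lists, last block first, the sizes of the blocks of consecutive
   strands that are the orbits of an increasing element. *)
Fixpoint block_value Q c : R :=
  if c is a :: c' then block_value (block_step a.-1 Q) c' else Q [::].

Definition zero_inv Q := forall u v, Q (u ++ 0%N :: v) = Q (u ++ v).
Definition zero_inv_state S := forall b, zero_inv (S b).

Lemma eq_kmul Phi Phi' : (forall b s, Phi b s = Phi' b s) ->
  forall b s, kmul Phi b s = kmul Phi' b s.
Proof.
move=> E b s; elim: s b Phi Phi' E => [|a s IH] b Phi Phi' E //=.
by apply: eq_bigr => g _; congr (_ * _); apply: IH.
Qed.

Lemma kmul_zero_inv S : zero_inv_state S -> zero_inv_state (kmul S).
Proof.
move=> zS b u v; elim: u b S zS => [|a u IH] b S zS /=.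
  rewrite big_ord1 kappa0 mul1r addn0; apply: eq_kmul => d w.
  exact: (zS d [::]).
apply: eq_bigr => g _; congr (_ * _); apply: IH => d w w'.
exact: (zS d (_ :: w)).
Qed.

Lemma top_state_zero_inv Q : zero_inv Q -> zero_inv_state (top_state Q).
Proof. by move=> zQ; apply: kmul_zero_inv => b u v; apply: (zQ (_ :: u)). Qed.

Lemma next_state_zero_inv S : zero_inv_state S -> zero_inv_state (next_state S).
Proof.
move=> zS; apply: kmul_zero_inv => b u v.
by apply: eq_bigr => i _; apply: (zS i (_ :: u)).
Qed.

(** * Evaluations as combinations of block values *)

Definition block_weight c : nat := sumn (map predn c).

Definition blocks_of_weight (k : nat) c :=
  (0%N \notin c) && (block_weight c == k).

Definition spanned_at (k : nat) :=
  spanned zero_inv (blocks_of_weight k) (fun c Q => block_value Q c).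

(** A state lives in the middle of a block. The number p.1 counts the further links before the block
    is closed; each costs one degree, which leaves k - p.1 for the other blocks. *)
Definition state_spanned_at (k : nat) :=
  spanned zero_inv_state
    (fun p : nat * seq nat => (p.1 <= k)%N && blocks_of_weight (k - p.1) p.2)
    (fun p S => block_value (iter p.1 next_state S 0%N) p.2).

Lemma state_spanned_top k F :
  state_spanned_at k F -> spanned_at k.+1 (fun Q => F (top_state Q)).
Proof.
case=> l al E; exists [seq (p.1, p.2.1.+2 :: p.2.2) | p <- l].
  rewrite all_map; apply: sub_all al => p /= /andP[le_k /andP[z /eqP w]].
  by rewrite /blocks_of_weight inE negb_or z /block_weight /= -/(block_weight _) w
    addSn subnKC //=.
by move=> Q zQ; rewrite E ?big_map //; apply: top_state_zero_inv.
Qed.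

Lemma spanned_state k F :
  spanned_at k F -> state_spanned_at k (fun S => F (S 0%N)).
Proof.
case=> l al E; exists [seq (p.1, (0%N, p.2)) | p <- l].
  by rewrite all_map; apply: sub_all al => p /=; rewrite subn0.
by move=> S zS; rewrite E ?big_map.
Qed.

Lemma state_spanned_next k F :
  state_spanned_at k F -> state_spanned_at k.+1 (fun S => F (next_state S)).
Proof.
case=> l al E; exists [seq (p.1, (p.2.1.+1, p.2.2)) | p <- l].
  by rewrite all_map; apply: sub_all al => p /=; rewrite ltnS subSS.
move=> S zS; rewrite E ?big_map; last exact: next_state_zero_inv.
by apply: eq_bigr => p _; rewrite iterSr.
Qed.

(** Since kappa has constant term 1, the choice g = 0 on every strand contributes [Phi b s] itself;
    any other choice moves a positive amount from s to b and keeps the total. Hence [kmul] can be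
    inverted by induction on [sumn s] without dividing. *)
Lemma kmul_unitriangular s b : exists2 l : seq (R * (nat * seq nat)),
  all (fun p => (sumn p.2.2 < sumn s)%N &&
                (p.2.1 + sumn p.2.2 == b + sumn s)%N) l &
  forall Phi, kmul Phi b s = Phi b s + \sum_(p <- l) p.1 * Phi p.2.1 p.2.2.
Proof.
elim: s b => [|a s IH] b; first by exists [::] => // Phi; rewrite big_nil addr0.
have [l0 al0 E0] := IH b.
suff key m : (m <= a)%N -> exists2 l : seq (R * (nat * seq nat)),
    all (fun p => (sumn p.2.2 < sumn (a :: s))%N &&
                  (p.2.1 + sumn p.2.2 == b + sumn (a :: s))%N) l &
    forall Phi, \sum_(g < m) kappa g.+1 *
        kmul (fun d u => Phi d ((a - g.+1)%N :: u)) (b + g.+1) s =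
      \sum_(p <- l) p.1 * Phi p.2.1 p.2.2.
  have [l al E] := key a (leqnn a).
  exists ([seq (p.1, (p.2.1, a :: p.2.2)) | p <- l0] ++ l).
    rewrite all_cat al andbT all_map; apply: sub_all al0 => p /= /andP[lt_p /eqP Ep].
    by rewrite ltn_add2l lt_p addnCA Ep addnCA eqxx.
  move=> Phi; rewrite /= big_ord_recl kappa0 mul1r subn0 addn0 E0 -addrA.
  by rewrite big_cat big_map /= -E.
elim: m => [|m IHm] le_m; first by exists [::] => // Phi; rewrite big_nil big_ord0.
have [l al E] := IHm (ltnW le_m); have [l1 al1 E1] := IH (b + m.+1)%N.
exists (l ++ (kappa m.+1, ((b + m.+1)%N, (a - m.+1)%N :: s)) ::
       [seq (kappa m.+1 * p.1, (p.2.1, (a - m.+1)%N :: p.2.2)) | p <- l1]).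
  rewrite all_cat al /= all_map; apply/andP; split; first by lia.
  by apply: sub_all al1 => p /=; lia.
move=> Phi; rewrite big_ord_recr E big_cat big_cons big_map E1 /=; congr (_ + _).
rewrite mulrDr mulr_sumr; congr (_ + _).
by apply: eq_bigr => p _; rewrite mulrA.
Qed.

Lemma spanned_kmul (X : Type) (ok : X -> Prop) (I : Type) (good : pred I)
    (e : I -> X -> R) (h : X -> nat -> seq nat -> R) n :
  (forall b s, (b + sumn s = n)%N -> spanned ok good e (fun x => kmul (h x) b s)) ->
  forall b s, (b + sumn s = n)%N -> spanned ok good e (fun x => h x b s).
Proof.
move=> Pk b s; move: {2}(sumn s) (leqnn (sumn s)) => m.
elim: m b s => [|m IH] b s le_m ns.
  have [l al E] := kmul_unitriangular s b.
  apply: eq_spanned (Pk b s ns) => x _; rewrite E big_seq big1 ?addr0 // => p pl.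
  by have := allP al p pl; lia.
have [l al E] := kmul_unitriangular s b.
have := @spanned_sub_sum R X ok I good e _ l (fun p => p.1) _
  (fun p x => h x p.2.1 p.2.2) _ (Pk b s ns).
move=> sp; apply: eq_spanned (sp _) => [x _|p pl]; first by rewrite E addrK.
have /= /andP[lt_p /eqP Ep] := allP al p pl.
by apply: IH; [rewrite -ltnS (leq_trans lt_p) | rewrite Ep].
Qed.

(** Zeros at the head are dropped by [zero_inv]. Once the head is positive, Q (d+1 :: u) is the
    function whose [kmul] is [top_state Q], and inverting [kmul] leaves values of a state in degree
    k. *)
Lemma spanned_value_step k :
  (forall b s, (b + sumn s = k)%N -> state_spanned_at k (fun S => S b s)) ->
  forall s, sumn s = k.+1 -> spanned_at k.+1 (fun Q => Q s).
Proof.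
move=> IH; elim=> [|[|a] s IHs] // Es.
  by apply: eq_spanned (IHs Es) => Q zQ; rewrite (zQ [::]).
apply: (@spanned_kmul _ _ _ _ _ (fun Q d u => Q (d.+1 :: u)) k); last first.
  by move: Es; rewrite /= addSn => -[].
by move=> b u E; apply: (state_spanned_top (IH b u E)).
Qed.

(** The last term of [merge_state S b s] is S (b+1) (0 :: s), that is S (b+1) s; all others have a
    smaller first argument. Induction on b isolates it, and [merge_state] itself is reached from
    [next_state] by inverting [kmul] in degree k. *)
Lemma state_spanned_value_step k :
  (forall b s, (b + sumn s = k)%N -> state_spanned_at k (fun S => S b s)) ->
  (forall s, sumn s = k.+1 -> spanned_at k.+1 (fun Q => Q s)) ->
  forall b s, (b + sumn s = k.+1)%N -> state_spanned_at k.+1 (fun S => S b s).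
Proof.
move=> IH sQ b; elim/ltn_ind: b => -[|b] IHb s Es; first exact: spanned_state (sQ s Es).
have sV : state_spanned_at k.+1 (fun S => merge_state S b s).
  apply: (@spanned_kmul _ _ _ _ _ merge_state k) => [d u E|]; last by lia.
  exact: (state_spanned_next (IH d u E)).
have := @spanned_sub_sum R _ _ _ _ _ _ (index_enum 'I_b.+1) (fun=> 1) _
  (fun i S => S (i : nat) ((b.+1 - i)%N :: s)) _ sV.
move=> sp; apply: eq_spanned (sp _) => [S zS|i _].
  rewrite /merge_state big_ord_recr /= subnn (zS _ [::]) addrC.
  by under [X in _ - X]eq_bigr do rewrite mul1r; rewrite addrK.
by apply: IHb => //=; have := ltn_ord i; lia.
Qed.

Lemma spanned_values k :
  (forall s, sumn s = k -> spanned_at k (fun Q => Q s)) /\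
  (forall b s, (b + sumn s = k)%N -> state_spanned_at k (fun S => S b s)).
Proof.
elim: k => [|k [_ IHS]]; last first.
  by split; [exact: spanned_value_step | exact/state_spanned_value_step/spanned_value_step].
suff Q0 s : sumn s = 0%N -> spanned_at 0 (fun Q => Q s).
  by split=> // -[|b] s Es //; apply: spanned_state (Q0 s Es).
move=> Es; exists [:: (1, [::])] => // Q zQ; rewrite big_seq1 mul1r /=.
by elim: s Es => [|[|a] s IHs] // Es; rewrite (zQ [::]) IHs.
Qed.

(** * Block values strand by strand *)

(* The extra exponent of a state is absorbed by the last remaining strand, so
   that the value can be computed strand by strand instead of block by block. *)
Definition flat_state S : seq nat -> R :=
  fun s => if s is a :: s' then \sum_(i < a.+1) S i ((a - i)%N :: s') else S 0%N [::].

Fixpoint bit_value Q (bs : bitseq) : R :=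
  match bs with
  | [::] => Q [::]
  | true :: bs' => bit_value (flat_state (top_state Q)) bs'
  | false :: bs' => bit_value (fun s => Q (0%N :: s)) bs'
  end.

Definition bits_of_blocks c : bitseq :=
  flatten [seq rcons (nseq a.-1 true) false | a <- c].

Lemma eq_bit_value Q Q' bs : Q =1 Q' -> bit_value Q bs = bit_value Q' bs.
Proof.
elim: bs Q Q' => [|[] bs IH] Q Q' E /=; first exact: E.
  apply: IH => -[|a s] /=; first by apply: eq_kmul => b s; apply: E.
  by apply: eq_bigr => i _; apply: eq_kmul => b u; apply: E.
by apply: IH => s; apply: E.
Qed.

(** At a positive head [flat_state S] is [merge_state S], so [top_state (flat_state S)] is
    convertible to [next_state S]. The false bit that closes a block reads [flat_state S] at head 0,
    which is the state at b = 0. *)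
Lemma bit_value_blocks Q c : zero_inv Q -> 0%N \notin c ->
  bit_value Q (bits_of_blocks c) = block_value Q c.
Proof.
elim: c Q => [|a c IH] Q zQ //; rewrite inE negb_or => /andP[a_gt0 c0].
rewrite /bits_of_blocks /= -/(bits_of_blocks c) cat_rcons.
case: a a_gt0 => // a _; case: a => [|a] /=.
  by rewrite -IH //; apply: eq_bit_value => s; apply: (zQ [::]).
move: (top_state_zero_inv zQ); move: (top_state Q) => S {zQ}.
elim: a S => [|a IHa] S zS /=.
  rewrite -IH; [|exact: zS | by []].
  apply: eq_bit_value => s /=; rewrite big_ord1; exact: (zS 0%N [::]).
rewrite -[next_state _]/(iter a.+1 next_state S) iterSr -IHa //.
exact: next_state_zero_inv.
Qed.

End CoefficientFunctions.

(** * Traces on algebras with Hecke relations *)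

Section HeckeRelations.
Variables (R : comNzRingType) (H : algType R) (xi : R) (N : nat) (t : nat -> H).
Hypothesis tt : forall i, (i < N)%N -> t i * t i = 1 + xi *: t i.
Hypothesis tC : forall i j, (i.+1 < j)%N -> t i * t j = t j * t i.
Hypothesis tB : forall i, (i.+1 < N)%N ->
  t i * t i.+1 * t i = t i.+1 * t i * t i.+1.

(* The subalgebra generated by t_0, ..., t_(m-1). *)
Inductive gal m : H -> Prop :=
| gal_one : gal m 1
| gal_add a b of gal m a & gal m b : gal m (a + b)
| gal_scale (c : R) a of gal m a : gal m (c *: a)
| gal_mulr_gen a i of (i < m)%N & gal m a : gal m (a * t i).

Lemma gal_zero m : gal m 0.
Proof. by rewrite -(scale0r 1); apply/gal_scale/gal_one. Qed.

Lemma gal_mul m a b : gal m a -> gal m b -> gal m (a * b).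
Proof.
move=> ga; elim=> [|b1 b2 _ g1 _ g2|c b1 _ g1|b1 i lt_i _ g1].
- by rewrite mulr1.
- by rewrite mulrDr; apply: gal_add.
- by rewrite -scalerAr; apply: gal_scale.
- by rewrite mulrA; apply: gal_mulr_gen.
Qed.

Lemma gal_gen m i : (i < m)%N -> gal m (t i).
Proof. by move=> lt_i; rewrite -[t i]mul1r; apply/gal_mulr_gen/gal_one. Qed.

Lemma gal_mono m m' a : (m <= m')%N -> gal m a -> gal m' a.
Proof.
move=> le_m; elim=> [|b1 b2 _ g1 _ g2|c b1 _ g1|b1 i lt_i _ g1].
- exact: gal_one.
- exact: gal_add.
- exact: gal_scale.
- by apply: gal_mulr_gen => //; apply: leq_trans le_m.
Qed.

Lemma gal_sum m (I : Type) (r : seq I) (P : pred I) F :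
  (forall i, P i -> gal m (F i)) -> gal m (\sum_(i <- r | P i) F i).
Proof.
move=> gF; elim/big_ind: _ => //; [exact: gal_zero | by move=> *; apply: gal_add].
Qed.

Lemma gal_comm m x a : (forall i, (i < m)%N -> GRing.comm x (t i)) ->
  gal m a -> GRing.comm x a.
Proof.
move=> cx; elim=> [|b1 b2 _ g1 _ g2|c b1 _ g1|b1 i lt_i _ g1].
- exact: commr1.
- exact: commrD.
- by rewrite /GRing.comm -scalerAr g1 scalerAl.
- by apply: commrM => //; apply: cx.
Qed.

Lemma gal_comm_gen m j a : (m < j)%N -> gal m a -> GRing.comm (t j) a.
Proof.
by move=> lt_m; apply: gal_comm => i lt_i; apply/esym/tC; lia.
Qed.

Lemma gal0 a : gal 0 a -> exists c : R, a = c%:A.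
Proof.
elim=> [|b1 b2 _ [c1 ->] _ [c2 ->]|c b1 _ [c1 ->]|//].
- by exists 1; rewrite scale1r.
- by exists (c1 + c2); rewrite scalerDl.
- by exists (c * c1); rewrite scalerA.
Qed.

(** * One more generator: gal m + gal m t_m gal m *)

Inductive gal_split m : H -> Prop :=
| gal_split_gal a of gal m a : gal_split m a
| gal_split_add a b of gal_split m a & gal_split m b : gal_split m (a + b)
| gal_split_gen a b of gal m a & gal m b : gal_split m (a * t m * b).

Lemma gal_split_scale m (c : R) a : gal_split m a -> gal_split m (c *: a).
Proof.
elim=> [b gb|b1 b2 _ g1 _ g2|b1 b2 g1 g2].
- by apply/gal_split_gal/gal_scale.
- by rewrite scalerDr; apply: gal_split_add.
- by rewrite !scalerAl; apply/gal_split_gen => //; apply: gal_scale.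
Qed.

Lemma gal_split_gen1 m a : gal m a -> gal_split m (a * t m).
Proof.
by move=> ga; rewrite -[_ * t m]mulr1; apply: gal_split_gen => //; apply: gal_one.
Qed.

Lemma gal_split_sq m a b : (m < N)%N -> gal m a -> gal m b ->
  gal_split m (a * (t m * t m) * b).
Proof.
move=> lt_m ga gb; rewrite tt // mulrDr mulr1 mulrDl.
apply: gal_split_add; first exact/gal_split_gal/gal_mul.
by rewrite -scalerAr -scalerAl; apply/gal_split_scale/gal_split_gen.
Qed.

(** Split b one level lower. A part from the smaller algebra commutes with t_m and the quadratic
    relation applies; in a part d1 t_(m-1) d2 the braid relation merges the two factors t_m into
    one. *)
Lemma gal_split_sandwich m a b : (m < N)%N -> (forall b', gal m b' ->
    if m is m'.+1 then gal_split m' b' else True) ->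
  gal m a -> gal m b -> gal_split m (a * t m * b * t m).
Proof.
case: m => [|m] lt_m IH ga gb.
  have [c ->] := gal0 gb.
  rewrite -scalerAr mulr1 -scalerAl -mulrA -[a * _]mulr1.
  by apply/gal_split_scale/gal_split_sq => //; apply: gal_one.
elim: (IH b gb) => [d gd|d1 d2 _ s1 _ s2|d1 d2 g1 g2].
- rewrite -mulrA -(gal_comm_gen (ltnSn m) gd) mulrA -[a * _ * _]mulrA.
  by apply: gal_split_sq => //; apply: gal_mono gd.
- by rewrite mulrDr mulrDl; apply: gal_split_add.
have -> : a * t m.+1 * (d1 * t m * d2) * t m.+1 =
    (a * d1 * t m) * t m.+1 * (t m * d2).
  rewrite !mulrA -[a * t m.+1 * d1]mulrA (gal_comm_gen (ltnSn m) g1).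
  rewrite -[X in X = _]mulrA -(gal_comm_gen (ltnSn m) g2) !mulrA.
  by rewrite -3![in LHS](mulrA (a * d1)) -tB // !mulrA.
apply: gal_split_gen; last by apply: gal_mul (gal_gen _) (gal_mono _ g2).
by apply: gal_mul (gal_gen _) => //; apply: gal_mul ga (gal_mono _ g1).
Qed.

Lemma gal_splitP m a : (m < N)%N -> gal m.+1 a -> gal_split m a.
Proof.
elim: m a => [|m IH] a lt_m; elim=> [|b1 b2 _ g1 _ g2|c b1 _ g1|b1 i lt_i _ g1];
  try by [apply/gal_split_gal/gal_one | apply: gal_split_add
         | apply: gal_split_scale].
- have -> : i = 0%N by lia.
  elim: g1 => [b gb|c1 c2 _ h1 _ h2|c1 c2 h1 h2]; first exact: gal_split_gen1.
  + by rewrite mulrDl; apply: gal_split_add.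
  + exact: gal_split_sandwich.
elim: g1 => [b gb|c1 c2 _ h1 _ h2|c1 c2 h1 h2].
- have [->|ne_i] := eqVneq i m.+1; first exact: gal_split_gen1.
  by apply/gal_split_gal/gal_mulr_gen => //; lia.
- by rewrite mulrDl; apply: gal_split_add.
have [->|ne_i] := eqVneq i m.+1; last first.
  by rewrite -mulrA; apply: gal_split_gen => //; apply: gal_mulr_gen => //; lia.
by apply: gal_split_sandwich => // b' gb'; apply: IH => //; apply: ltnW.
Qed.

(** * Jucys-Murphy elements from the Hecke relations *)

Fixpoint jm (m : nat) : H :=
  if m is m'.+1 then t m' * jm m' * t m' + t m' else 0.

Lemma jm_gal m : gal m (jm m).
Proof.
elim: m => [|m IH] /=; first exact: gal_zero.
apply: gal_add; last exact: gal_gen.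
by apply: gal_mulr_gen => //; apply: gal_mul (gal_gen _) (gal_mono _ IH).
Qed.

Lemma jm_comm_gen j m : (m <= N)%N -> j != m -> j.+1 != m ->
  GRing.comm (t j) (jm m).
Proof.
move=> le_m ne1 ne2; have [lt_m|] := ltnP m j.
  exact: gal_comm_gen (jm_gal m).
rewrite leq_eqVlt (negbTE ne1) /= => lt_j.
elim: m {ne1} ne2 le_m lt_j => [|m IH] // ne2 le_m lt_j.
have [Em|ne_m] := eqVneq j.+1 m; last first.
  have lt_jm : (j.+1 < m)%N by lia.
  have cm : GRing.comm (t j) (t m) by rewrite /GRing.comm tC.
  by rewrite /=; apply: commrD => //; do 2?apply: commrM => //; apply: IH => //; lia.
(* The essential case: with u = t_j, v = t_(j+1), z = L_j the element is v (u z u + u) v + v. The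
   summand v u z u v commutes with u by itself, whereas for v u v and v only their sum does. *)
rewrite -Em /= {IH ne2 lt_j} in le_m *; subst m.
have cz : GRing.comm (t j.+1) (jm j) by apply: gal_comm_gen (jm_gal j).
set u := t j; set v := t j.+1; set z := jm j.
have B : u * v * u = v * u * v by apply: tB.
have uu : u * u = 1 + xi *: u by apply: tt; lia.
rewrite /GRing.comm !(mulrDr, mulrDl).
have -> : u * (v * (u * z * u) * v) = v * (u * z * u) * v * u.
  transitivity (v * u * (v * z) * u * v); first by rewrite !mulrA B -!mulrA.
  rewrite cz; transitivity (v * u * z * (v * u * v)); first by rewrite !mulrA.
  by rewrite -B !mulrA.
rewrite -!addrA; congr (_ + _).
have -> : u * (v * u * v) = v * u + xi *: (u * v * u).
  by rewrite -B !mulrA uu !mulrDl mul1r -!scalerAl.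
have -> : v * u * v * u = u * v + xi *: (u * v * u).
  by rewrite -B -mulrA uu mulrDr mulr1 -scalerAr.
by rewrite addrAC [in RHS]addrAC [u * v + _]addrC.
Qed.

Lemma gal_jm_comm m a : (m < N)%N -> gal m a -> GRing.comm (jm m.+1) a.
Proof.
move=> lt_m; apply: gal_comm => i lt_i.
by apply/esym/jm_comm_gen => //; lia.
Qed.

Lemma jm_comm i j : (i <= N)%N -> (j <= N)%N -> GRing.comm (jm i) (jm j).
Proof.
wlog lt_ij : i j / (i < j)%N => [th le_i le_j|le_i].
  case: (ltngtP i j) => [/th|/th c|->]; [exact | exact/esym/c | exact: commr_refl].
case: j lt_ij => // j lt_ij le_j; apply/esym/gal_jm_comm => //.
exact: gal_mono (jm_gal i).
Qed.

Lemma jm_mul_gen m : (m < N)%N ->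
  jm m.+1 * t m = t m * jm m + 1 + xi *: jm m.+1.
Proof.
move=> lt_m; rewrite /= mulrDl -mulrA tt // mulrDr mulr1 -scalerAr -!addrA.
by congr (_ + _); rewrite addrCA scalerDr.
Qed.

Lemma gen_mul_jm m : (m < N)%N ->
  t m * jm m.+1 = jm m * t m + 1 + xi *: jm m.+1.
Proof.
move=> lt_m; rewrite /= mulrDr !mulrA tt // !mulrDl mul1r -!scalerAl -!addrA.
by congr (_ + _); rewrite addrCA scalerDr.
Qed.

(** * Conditional expectations of powers *)

Variable tau : {scalar H}.
Hypothesis tauC : forall a b, tau (a * b) = tau (b * a).
Hypothesis tau_one : tau 1 = 1.
Hypothesis tau_gal : forall m a, (m < N)%N -> gal m a -> tau (a * t m) = 0.

Lemma tauZ (c : R) a : tau (c *: a) = c * tau a. Proof. exact: linearZ. Qed.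

(* [exp_jm m a] and [exp_jm_gen m a] are the images of L_m^a and L_(m+1)^a t_m
   under the conditional expectations onto the smaller algebras; exp_step
   computes the pair (exp_jm (m+1) a - exp_jm m a, exp_jm_gen m a). *)
Fixpoint exp_step (x : H) (P : nat -> H) (a : nat) : H * H :=
  if a is a'.+1 then
    let: (d, r) := exp_step x P a' in
    let d' := x * d + r + xi *: (x * r) in
    (d', x * r + (P a' + d) + xi *: (P a'.+1 + d'))
  else (0, 0).

Fixpoint exp_jm (m a : nat) : H :=
  if m is m'.+1 then exp_jm m' a + (exp_step (jm m') (exp_jm m') a).1
  else (a == 0%N)%:R.

Definition exp_diff (m a : nat) := (exp_step (jm m) (exp_jm m) a).1.
Definition exp_jm_gen (m a : nat) := (exp_step (jm m) (exp_jm m) a).2.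

Lemma exp_jmS (m a : nat) : exp_jm m.+1 a = exp_jm m a + exp_diff m a.
Proof. by []. Qed.

Lemma exp_diffS (m a : nat) : exp_diff m a.+1 =
  jm m * exp_diff m a + exp_jm_gen m a + xi *: (jm m * exp_jm_gen m a).
Proof. by rewrite /exp_diff /exp_jm_gen /=; case: exp_step. Qed.

Lemma exp_jm_genS (m a : nat) : exp_jm_gen m a.+1 =
  jm m * exp_jm_gen m a + exp_jm m.+1 a + xi *: exp_jm m.+1 a.+1.
Proof.
by rewrite !exp_jmS exp_diffS /exp_diff /exp_jm_gen /=; case: exp_step.
Qed.

Arguments exp_jm : simpl never.

Lemma exp_jm0 m : exp_jm m 0 = 1.
Proof. by elim: m => // m IH; rewrite exp_jmS IH addr0. Qed.

Lemma exp_step_gal m : (forall c, gal m (exp_jm m c)) ->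
  forall c, gal m (exp_diff m c) /\ gal m (exp_jm_gen m c).
Proof.
move=> gP; elim=> [|c [gd gr]]; first by split; exact: gal_zero.
have gx := jm_gal m; have gP0 := gP c; have gP1 := gP c.+1.
split; rewrite ?exp_diffS ?exp_jm_genS ?exp_jmS ?exp_diffS;
  by do ?[apply: gal_add => // | apply: gal_scale => // | apply: gal_mul => //].
Qed.

Lemma exp_jm_gal m c : gal m (exp_jm m c).
Proof.
elim: m c => [|m IH] c.
  by rewrite /exp_jm; case: eqP => _; [exact: gal_one | exact: gal_zero].
rewrite exp_jmS; have [gd _] := exp_step_gal IH c.
by apply: gal_add; exact: gal_mono (leqnSn m) _.
Qed.

Lemma exp_jm_galS m c : gal m (exp_jm m.+1 c).
Proof.
rewrite exp_jmS; have [gd _] := exp_step_gal (exp_jm_gal m) c.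
by apply: gal_add => //; exact: exp_jm_gal.
Qed.

Lemma exp_jm_comm (m a : nat) : (m <= N)%N -> GRing.comm (jm m) (exp_jm m a).
Proof.
case: m => [|m] le_m; last exact: gal_jm_comm (exp_jm_galS _ _).
by rewrite /GRing.comm mul0r mulr0.
Qed.

Lemma exp_step_comm (m a : nat) : (m <= N)%N ->
  GRing.comm (jm m) (exp_diff m a) /\ GRing.comm (jm m) (exp_jm_gen m a).
Proof.
move=> le_m; have cZ (c : R) b : GRing.comm (jm m) b -> GRing.comm (jm m) (c *: b).
  by rewrite /GRing.comm -scalerAr -scalerAl => ->.
have cx := commr_refl (jm m); have cP c := exp_jm_comm c le_m.
elim: a => [|a [cd cr]]; first by split; exact: commr0.
have cd' : GRing.comm (jm m) (exp_diff m a.+1).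
  rewrite exp_diffS.
  by do ?[apply: commrD | apply: cZ | apply: commrM].
split=> //; rewrite exp_jm_genS !exp_jmS.
by do ?[apply: commrD | apply: cZ | apply: commrM].
Qed.

(** The expectation of t_m g t_m onto gal m is that of g one level lower. It is tested by splitting
    h: if h lies in the smaller algebra it commutes with t_m, and t_m^2 = 1 + xi t_m leaves g; if h
    = a t_(m-1) b, the braid relation shows that both sides vanish. *)
Lemma tau_sandwich m h c : (m < N)%N ->
  (forall m' h' c', m = m'.+1 -> gal m' h' ->
     tau (h' * jm m ^+ c') = tau (h' * exp_jm m c')) ->
  gal m h -> tau (h * t m * jm m ^+ c * t m) = tau (h * exp_jm m c).
Proof.
case: m => [|m] lt_m IH gh.
  have [k ->] := gal0 gh; rewrite /exp_jm /= expr0n -scalerAl mul1r.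
  rewrite -!scalerAl !linearZ /=; case: (c == _); rewrite /= ?mulr1 ?mulr0 ?mul0r //.
  rewrite tt // linearD linearZ /= -[t 0]mul1r.
  by rewrite tau_gal ?mulr0 ?addr0 ?mul1r ?mulr1 //; exact: gal_one.
set g := jm m.+1 ^+ c; set v := t m.+1.
have gg : gal m.+1 g.
  rewrite /g; elim: c {g} => [|c]; first by rewrite expr0; apply: gal_one.
  by rewrite exprS; apply: gal_mul; exact: jm_gal.
have gE := exp_jm_galS m c.
have {IH} := fun h' => IH m h' c erefl.
move: (exp_jm _ _) gE => E gE; rewrite -/g => IH.
elim: (gal_splitP (ltnW lt_m) gh) => [a ga|a b _ Ea _ Eb|a b ga gb].
- have cva : GRing.comm v a by apply: gal_comm_gen ga.
  rewrite -cva -!mulrA tauC -!mulrA tt // !mulrDr mulr1 linearD.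
  rewrite -!scalerAr tauZ mulrA tau_gal ?mulr0 ?addr0 //; last first.
    by apply: gal_mul gg; apply: gal_mono ga.
  exact: IH.
- by rewrite !mulrDl !linearD Ea Eb.
have gb' : gal m.+1 b by apply: gal_mono gb.
have ga' : gal m.+1 a by apply: gal_mono ga.
have cva : GRing.comm v a by apply: gal_comm_gen ga.
have cvb : GRing.comm v b by apply: gal_comm_gen gb.
transitivity (0 : R); last first.
  rewrite -(mulrA (a * t m)) tauC mulrA tau_gal //; first exact: ltnW.
  by apply: gal_mul => //; apply: gal_mul.
transitivity (tau (t m * b * g * a * t m * v)); last first.
  by apply: tau_gal => //; do !apply: gal_mul => //; exact: gal_gen.
have -> : a * t m * b * v * g * v = a * t m * v * b * g * v.
  by rewrite -(mulrA (a * t m)) -cvb !mulrA.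
rewrite tauC !mulrA cva -(mulrA a) -(mulrA a) -tB // tauC.
have -> : t m * b * g * a * t m * v = (t m * b) * (g * a * t m * v) by rewrite !mulrA.
by rewrite [RHS]tauC !mulrA.
Qed.

Lemma tau_exp m : (m < N)%N -> forall c h, gal m h ->
  tau (h * jm m.+1 ^+ c) = tau (h * exp_jm m.+1 c) /\
  tau (h * jm m.+1 ^+ c * t m) = tau (h * exp_jm_gen m c).
Proof.
elim: m => [|m IHm] lt_m.
Abort.

(** Write x = L_m and y = L_(m+1). Expanding y = t x t + t produces mixed moments of y^c t x^d t, so
    these are computed along with the two claims, for all d at once. The relation y t = t x + 1 + xi
    y passes from c to c + 1 at the price of replacing d by d + 1. *)
Lemma tau_exp_step m : (m < N)%N ->
  (forall h c, gal m h -> tau (h * t m * jm m ^+ c * t m) = tau (h * exp_jm m c)) ->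
  forall c, (forall h, gal m h ->
    tau (h * jm m.+1 ^+ c) = tau (h * exp_jm m.+1 c)) /\
  (forall h, gal m h -> tau (h * jm m.+1 ^+ c * t m) = tau (h * exp_jm_gen m c)).
Proof.
move=> lt_m sand.
have cxy : GRing.comm (jm m) (jm m.+1) by apply: jm_comm => //; exact: ltnW.
have gx d : gal m (jm m ^+ d).
  elim: d => [|d]; first by rewrite expr0; apply: gal_one.
  by rewrite exprS; apply: gal_mul; exact: jm_gal.
have Ey := jm_mul_gen lt_m.
move: (exp_diffS m) (exp_jm_genS m) (exp_jmS m) (fun c => (exp_step_comm c (ltnW lt_m)).2).
have : exp_diff m 0 = 0 by []. 
have : exp_jm_gen m 0 = 0 by [].
have Dy : jm m.+1 = t m * jm m * t m + t m by [].
move: (exp_jm m) sand (exp_jm m.+1) (exp_diff m) (exp_jm_gen m) => P0 sand P D r r0 D0 DS rS PE rx.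
move: (jm m) (jm m.+1) cxy gx Ey Dy sand DS rS rx => x y cxy gx Ey Dy sand DS rS rx.
(* The mixed moment with d = 0 contains t^2 = 1 + xi t, so it yields the moment of y^c once that of
   y^c t is known. *)
have Aof c : (forall h, gal m h -> tau (h * y ^+ c * t m) = tau (h * r c)) ->
    (forall h d, gal m h -> tau (h * y ^+ c * t m * x ^+ d * t m) =
       tau (h * P0 (c + d)%N) + tau (h * x ^+ d * (D c + xi *: r c))) ->
    forall h, gal m h -> tau (h * y ^+ c) = tau (h * P c).
  move=> Br C h gh; have := C h 0%N gh.
  rewrite addn0 expr0 !mulr1 -[_ * t m * t m]mulrA tt //.
  rewrite !mulrDr mulr1 !linearD -!scalerAr !tauZ Br // addrA.
  by move/addIr => ->; rewrite PE mulrDr linearD.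
suff main c : (forall h, gal m h -> tau (h * y ^+ c * t m) = tau (h * r c)) /\
    (forall h d, gal m h -> tau (h * y ^+ c * t m * x ^+ d * t m) =
       tau (h * P0 (c + d)%N) + tau (h * x ^+ d * (D c + xi *: r c))).
  by move=> c; have [Br C] := main c; split=> //; apply: Aof.
elim: c => [|c [Br C]].
  split=> [h gh|h d gh]; first by rewrite expr0 mulr1 r0 mulr0 linear0 tau_gal.
  by rewrite expr0 mulr1 D0 r0 scaler0 addr0 mulr0 linear0 addr0 sand.
have Ac := Aof c Br C.
have cxyn d e : GRing.comm (x ^+ d) (y ^+ e) by apply: commrX; apply/commr_sym/commrX/commr_sym.
have A h : gal m h -> tau (h * y ^+ c.+1) = tau (h * P c.+1).
  move=> gh; rewrite exprSr {2}Dy mulrDr mulrDr linearD.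
  have := C h 1%N gh; rewrite expr1 addn1 -!mulrA => ->.
  rewrite (mulrA h (y ^+ c)) Br // PE DS [in RHS]mulrDr [in RHS]linearD -addrA; congr (_ + _).
  rewrite -linearD -mulrDr; congr (tau (_ * _)).
  by rewrite mulrDr -scalerAr addrAC.
have B h : gal m h -> tau (h * y ^+ c.+1 * t m) = tau (h * r c.+1).
  move=> gh; rewrite exprSr mulrA -(mulrA _ y) Ey !mulrDr mulr1 !linearD.
  rewrite -scalerAr tauZ -(mulrA h _ y) -exprSr A // (mulrA _ (t m)) tauC !mulrA.
  rewrite Br; last by apply: gal_mul => //; have := gx 1%N; rewrite expr1.
  rewrite Ac // rS !mulrDr !linearD -scalerAr tauZ; congr (_ + _ + _).
  by rewrite -mulrA tauC -mulrA -rx.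
split=> // h d gh; rewrite exprSr mulrA -(mulrA _ y) Ey !(mulrDr, mulrDl) mulr1 !linearD.
have ghx : gal m (h * x ^+ d) by apply: gal_mul.
have -> : tau (h * y ^+ c * x ^+ d * t m) = tau (h * x ^+ d * r c).
  by rewrite -Br // -(mulrA h (y ^+ _)) -cxyn !mulrA.
have -> : tau (h * y ^+ c * (xi *: y) * x ^+ d * t m) = xi * tau (h * x ^+ d * r c.+1).
  rewrite -!scalerAr -!scalerAl tauZ -(mulrA h _ y) -exprSr -B //.
  by rewrite -(mulrA h (y ^+ _)) -cxyn !mulrA.
have := C h d.+1 gh; rewrite addnS exprS !mulrA => ->.
rewrite -(mulrA h x) -exprS exprSr mulrA addSn -!addrA -tauZ -!linearD.
congr (tau (_ + _)); rewrite -(mulrA _ x) scalerAr -!mulrDr; congr (_ * _).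
by rewrite addrA; congr (_ + _); rewrite DS mulrDr -scalerAr addrAC.
Qed.

Lemma tau_exp m c h : (m < N)%N -> gal m h ->
  tau (h * jm m.+1 ^+ c) = tau (h * exp_jm m.+1 c).
Proof.
elim: m c h => [|m IH] c h lt_m gh.
  apply: (tau_exp_step lt_m _ c).1 => // h' c' gh'.
  exact: tau_sandwich.
apply: (tau_exp_step lt_m _ c).1 => // h' c' gh'.
by apply: tau_sandwich => // m' h1 c1 [<-] gh1; apply: IH => //; apply: ltnW.
Qed.

Lemma tau_exp_gen m c h : (m < N)%N -> gal m h ->
  tau (h * jm m.+1 ^+ c * t m) = tau (h * exp_jm_gen m c).
Proof.
move=> lt_m gh; apply: (tau_exp_step lt_m _ c).2 => // h' c' gh'.
apply: tau_sandwich => // m' h1 c1 Em; subst m => gh1.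
by apply: tau_exp => //; apply: ltnW.
Qed.

(** * Degree filtration *)

(* Linear combinations of products of fewer than d elements L_i with i < m. *)
Inductive fil (m : nat) : nat -> H -> Prop :=
| fil_zero d : fil m d 0
| fil_add d a b of fil m d a & fil m d b : fil m d (a + b)
| fil_scale d (c : R) a of fil m d a : fil m d (c *: a)
| fil_one d : fil m d.+1 1
| fil_mull_jm d i a of (i < m)%N & fil m d a : fil m d.+1 (jm i * a).

Lemma fil_mono m m' d d' a : (m <= m')%N -> (d <= d')%N ->
  fil m d a -> fil m' d' a.
Proof.
move=> le_m le_d fa; elim: fa d' le_d => {d a}
  [d|d a b _ fa _ fb|d c a _ fa|d|d i a lt_i _ fa] d' le_d.
- exact: fil_zero.
- by apply: fil_add; [apply: fa | apply: fb].
- by apply/fil_scale/fa.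
- by case: d' le_d => // d' _; apply: fil_one.
- by case: d' le_d => // d' le_d; apply: fil_mull_jm (fa _ _) => //; apply: leq_trans le_m.
Qed.

Lemma fil0_eq m a : fil m 0 a -> a = 0.
Proof.
move Ed: 0%N => d fa; elim: d a / fa Ed => //.
- by move=> d a b _ Ea _ Eb Ed; rewrite Ea // Eb // addr0.
- by move=> d c a _ Ea Ed; rewrite Ea // scaler0.
Qed.

Lemma fil_sum m d (I : Type) (r : seq I) (P : pred I) F :
  (forall i, P i -> fil m d (F i)) -> fil m d (\sum_(i <- r | P i) F i).
Proof.
by move=> fF; elim/big_ind: _ => //; [exact: fil_zero | exact: fil_add].
Qed.

Lemma fil_mul m d e a b : fil m d a -> fil m e b -> fil m (d + e).-1 (a * b).
Proof.
move=> fa fb; elim: fa => {d a} [d|d a1 a2 _ f1 _ f2|d c a _ f1|d|d i a lt_i fa f1].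
- by rewrite mul0r; apply: fil_zero.
- by rewrite mulrDl; apply: fil_add.
- by rewrite -scalerAl; apply: fil_scale.
- by rewrite mul1r; apply: fil_mono fb => //; apply: leq_addl.
rewrite -mulrA addSn /=; case: d fa f1 => [|d] fa f1.
  by rewrite (fil0_eq fa) mul0r mulr0; apply: fil_zero.
by rewrite addSn; apply: fil_mull_jm.
Qed.

Lemma fil_mull_jmX m d i k a : (i < m)%N -> fil m d a -> fil m (k + d) (jm i ^+ k * a).
Proof.
move=> lt_i fa; elim: k => [|k IH]; first by rewrite expr0 mul1r.
by rewrite exprS -mulrA addSn; apply: fil_mull_jm.
Qed.

Lemma fil_gal m d a : fil m.+1 d a -> gal m a.
Proof.
elim=> {d a} [d|d a b _ ga _ gb|d c a _ ga|d|d i a lt_i _ ga].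
- exact: gal_zero.
- exact: gal_add.
- exact: gal_scale.
- exact: gal_one.
- by apply: gal_mul => //; apply: gal_mono (jm_gal i).
Qed.

Lemma fil_jm_comm m i d a : (m <= N.+1)%N -> (i <= N)%N -> fil m d a ->
  GRing.comm (jm i) a.
Proof.
move=> le_m le_i; elim=> {d a} [d|d a b _ ga _ gb|d c a _ ga|d|d j a lt_j _ ga].
- exact: commr0.
- exact: commrD.
- by rewrite /GRing.comm -scalerAr ga scalerAl.
- exact: commr1.
- by apply: commrM => //; apply: jm_comm => //; lia.
Qed.

Lemma fil_exp_step m : (forall c, fil m.+1 c.+1 (exp_jm m c.+1)) ->
  forall c, fil m.+1 c (exp_diff m c) /\ fil m.+1 c (exp_jm_gen m c).
Proof.
move=> fP; elim=> [|c [fd fr]]; first by split; exact: fil_zero.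
have fd' : fil m.+1 c.+1 (exp_diff m c.+1).
  rewrite exp_diffS; apply: fil_add; last exact/fil_scale/fil_mull_jm.
  by apply: fil_add; [exact: fil_mull_jm | exact: fil_mono fr].
split=> //; rewrite exp_jm_genS; apply: fil_add.
  apply: fil_add; first exact: fil_mull_jm.
  case: c fd {fr fd'} => [|c] fd; first by rewrite exp_jm0; apply: fil_one.
  by rewrite exp_jmS; apply: fil_add; [exact: fil_mono (fP c) | exact: fil_mono fd].
by rewrite exp_jmS; apply/fil_scale/fil_add.
Qed.

Lemma fil_exp_jm m c : fil m c.+1 (exp_jm m c.+1).
Proof.
elim: m c => [|m IH] c; first exact: fil_zero.
rewrite exp_jmS; apply: fil_add; first exact: fil_mono (IH c).
by have [] := @fil_exp_step m (fun d => fil_mono (leqnSn m) (leqnn _) (IH d)) c.+1.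
Qed.

Lemma fil_exp_jm_gen m c : fil m.+1 c (exp_jm_gen m c).
Proof.
by have [] := @fil_exp_step m
  (fun d => fil_mono (leqnSn m) (leqnn _) (fil_exp_jm m d)) c.
Qed.

(** * Leading parts of the expectations *)

(* The product over i < m of the series kappa(L_i u), in degree j. *)
Fixpoint kappa_jm (m j : nat) : H :=
  if m is m'.+1 then
    \sum_(g < j.+1) kappa xi g *: (jm m' ^+ g * kappa_jm m' (j - g))
  else (j == 0%N)%:R.

Definition jm_conv (m : nat) (f : nat -> R) (j : nat) : H :=
  \sum_(g < j.+1) f g *: (jm m ^+ g * kappa_jm m (j - g)).

(** The part of degree j of [exp_jm m j.+1]; note the shift. Strand i contributes xi theta(L_i u)
    times the product of kappa(L_l u) over l < i. *)
Fixpoint top_exp (m j : nat) : H :=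
  if m is m'.+1 then top_exp m' j + xi *: jm_conv m' (theta xi) j else 0.

(** The part of degree c - 1 of [exp_jm_gen m c]: the coefficient of u^c in u / (1 - L_m u) times
    the product of kappa(L_i u) over i <= m. *)
Definition top_exp_gen (m c : nat) : H :=
  \sum_(b < c) jm m ^+ b * kappa_jm m.+1 (c.-1 - b).

Lemma jm_convS m f j : jm_conv m f j.+1 =
  f 0%N *: kappa_jm m j.+1 + jm m * jm_conv m (fun g => f g.+1) j.
Proof.
rewrite /jm_conv big_ord_recl expr0 mul1r subn0 mulr_sumr; congr (_ + _).
by apply: eq_bigr => g _; rewrite -scalerAr exprS mulrA.
Qed.

Lemma jm_convD m f g j :
  jm_conv m (fun i => f i + g i) j = jm_conv m f j + jm_conv m g j.
Proof. by rewrite -big_split; apply: eq_bigr => i _; rewrite scalerDl. Qed.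

Lemma jm_conv0 m f : jm_conv m f 0 = f 0%N *: 1.
Proof.
rewrite /jm_conv big_ord1 expr0 mul1r subnn; congr (_ *: _).
elim: m => //= m IH; by rewrite big_ord1 subn0 kappa0 scale1r mul1r.
Qed.

Lemma eq_jm_conv m f g j : f =1 g -> jm_conv m f j = jm_conv m g j.
Proof. by move=> E; apply: eq_bigr => i _; rewrite E. Qed.

Lemma kappa_jmS m j : kappa_jm m.+1 j = jm_conv m (kappa xi) j.
Proof. by []. Qed.

Lemma kappa_jm0 m : kappa_jm m 0 = 1.
Proof. by case: m => // m; rewrite kappa_jmS jm_conv0 kappa0 scale1r. Qed.

(** Telescoping with kappa = 1 + xi^2 theta. The right-hand side is what the last two terms of
    [exp_jm_genS] contribute in top degree, which is how the product of the kappa series arises. *)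
Lemma kappa_jm_top m j : kappa_jm m j = (j == 0%N)%:R + xi *: top_exp m j.
Proof.
elim: m => [|m IH]; first by rewrite /= scaler0 addr0.
rewrite kappa_jmS /= scalerDr addrA -IH.
rewrite (eq_jm_conv _ _ (fun g => erefl : kappa xi g = _ + _)) jm_convD; congr (_ + _).
  rewrite /jm_conv big_ord_recl expr0 mul1r subn0 scale1r big1 ?addr0 //.
  by move=> i _; rewrite scale0r.
rewrite scalerA /jm_conv scaler_sumr; apply: eq_bigr => g _.
by rewrite scalerA -expr2.
Qed.

Lemma top_exp_genS m c : top_exp_gen m c.+2 =
  jm m * top_exp_gen m c.+1 + kappa_jm m.+1 c.+1.
Proof.
rewrite /top_exp_gen big_ord_recl expr0 mul1r subn0 addrC mulr_sumr.
by congr (_ + _); apply: eq_bigr => i _; rewrite exprS mulrA.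
Qed.

Lemma top_exp_genE m c : top_exp_gen m c.+1 = jm_conv m (rho xi) c.
Proof.
elim: c => [|c IH].
  by rewrite /top_exp_gen big_ord1 expr0 mul1r kappa_jm0 jm_conv0 rho0 scale1r.
rewrite top_exp_genS IH kappa_jmS [RHS]jm_convS [X in _ + X]jm_convS addrCA.
rewrite rho0 kappa0; congr (_ + _); rewrite -mulrDr -jm_convD.
by congr (_ * _); apply: eq_jm_conv => g; rewrite rhoS /kappa add0r.
Qed.

Lemma jm_conv_theta m c : jm_conv m (theta xi) c.+1 =
  jm m * jm_conv m (theta xi) c + jm m * top_exp_gen m c.+1.
Proof.
rewrite jm_convS theta0 scale0r add0r top_exp_genE -mulrDr -jm_convD.
by congr (_ * _); apply: eq_jm_conv => g; rewrite thetaS.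
Qed.

(** The recursion of [exp_step] modulo lower degree. In [exp_diffS] the bare term [exp_jm_gen] drops
    out; in [exp_jm_genS] the bare term [exp_jm] drops out too, except in its first instance, where
    it is 1. *)
Lemma top_exp_step m :
  (forall c, fil m.+1 c (exp_jm m c.+1 - top_exp m c)) ->
  forall c, fil m.+1 c (exp_diff m c.+1 - xi *: jm_conv m (theta xi) c) /\
            fil m.+1 c (exp_jm_gen m c.+1 - top_exp_gen m c.+1).
Proof.
move=> fP.
have fS c : fil m.+1 c (exp_diff m c.+1 - xi *: jm_conv m (theta xi) c) ->
    fil m.+1 c (exp_jm m.+1 c.+1 - top_exp m.+1 c).
  move=> fd; rewrite exp_jmS /= opprD addrACA; exact: fil_add (fP c) fd.
elim=> [|c [fd fr]].
  have fd0 : fil m.+1 0 (exp_diff m 1 - xi *: jm_conv m (theta xi) 0).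
    rewrite jm_conv0 theta0 scale0r scaler0 subr0 exp_diffS.
    rewrite -[exp_diff m 0]/(0 : H) -[exp_jm_gen m 0]/(0 : H).
    by rewrite !mulr0 scaler0 !addr0; apply: fil_zero.
  split=> //; rewrite exp_jm_genS exp_jm0 -[exp_jm_gen m 0]/(0 : H) mulr0 add0r.
  have /fil0_eq/eqP := fS _ fd0; rewrite subr_eq0 => /eqP ->.
  have -> : top_exp m.+1 0 = 0.
    elim: (m.+1) => // k IH; by rewrite /= IH jm_conv0 theta0 scale0r scaler0 addr0.
  rewrite scaler0 addr0 /top_exp_gen big_ord1 expr0 mul1r kappa_jm0 subrr.
  exact: fil_zero.
have fr1 := fil_exp_jm_gen m c.+1.
have fd1 : fil m.+1 c.+1 (exp_diff m c.+2 - xi *: jm_conv m (theta xi) c.+1).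
  rewrite exp_diffS jm_conv_theta scalerDr opprD addrACA -addrA addrACA.
  rewrite -scalerBr -mulrBr scalerAr -mulrBr addrCA.
  apply: fil_add; first exact: fr1.
  apply: fil_add; [exact: fil_mull_jm | exact/fil_scale/fil_mull_jm].
split=> //; rewrite exp_jm_genS top_exp_genS kappa_jm_top /= add0r.
rewrite opprD addrACA [X in X + _]addrAC -addrA -mulrBr -scalerBr.
apply: fil_add; first exact: fil_mull_jm.
apply: fil_add; last exact/fil_scale/fS.
rewrite exp_jmS; apply: fil_add; first exact: fil_mono (fil_exp_jm m c).
by have [] := @fil_exp_step m
  (fun d => fil_mono (leqnSn m) (leqnn _) (fil_exp_jm m d)) c.+1.
Qed.

Lemma top_expP m c : fil m c (exp_jm m c.+1 - top_exp m c).
Proof.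
elim: m c => [|m IH] c; first by rewrite subr0; apply: fil_zero.
rewrite exp_jmS /= opprD addrACA; apply: fil_add.
  exact: fil_mono (IH c).
by have [] := @top_exp_step m (fun d => fil_mono (leqnSn m) (leqnn _) (IH d)) c.
Qed.

Lemma top_exp_genP m c : fil m.+1 c.-1 (exp_jm_gen m c - top_exp_gen m c).
Proof.
case: c => [|c].
  by rewrite /top_exp_gen big_ord0 subr0; apply: fil_zero.
by have [] := @top_exp_step m
  (fun d => fil_mono (leqnSn m) (leqnn _) (top_expP m d)) c.
Qed.

(** * Evaluation of coefficient functions *)

(* The sum of Q(s) L^s over the exponent sequences s of length m and sum k. *)
Fixpoint jm_eval (m k : nat) (Q : seq nat -> R) : H :=
  if m is m'.+1 then
    \sum_(a < k.+1) jm_eval m' (k - a) (fun s => Q (nat_of_ord a :: s)) * jm m' ^+ a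
  else if k is 0%N then (Q [::])%:A else 0.

Lemma eq_jm_eval m k Q Q' : Q =1 Q' -> jm_eval m k Q = jm_eval m k Q'.
Proof.
elim: m k Q Q' => [|m IH] k Q Q' E /=; first by rewrite E.
by apply: eq_bigr => a _; congr (_ * _); apply: IH => s; apply: E.
Qed.

Lemma jm_eval_sum m k n (c : nat -> R) (Q : nat -> seq nat -> R) :
  jm_eval m k (fun s => \sum_(i < n) c i * Q i s) =
  \sum_(i < n) c i *: jm_eval m k (Q i).
Proof.
elim: m k Q => [|m IH] k Q /=.
  case: k => [|k]; first by rewrite scaler_suml; apply: eq_bigr => i _; rewrite scalerA.
  by rewrite big1 // => i _; rewrite scaler0.
under [RHS]eq_bigr do rewrite scaler_sumr.
rewrite exchange_big; apply: eq_bigr => a _ /=.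
rewrite (IH _ (fun i s => Q i (nat_of_ord a :: s))) mulr_suml.
by apply: eq_bigr => i _; rewrite scalerAl.
Qed.

Lemma fil_jm_eval m k Q : fil m k.+1 (jm_eval m k Q).
Proof.
elim: m k Q => [|m IH] k Q /=.
  by case: k => [|k]; [apply/fil_scale/fil_one | exact: fil_zero].
apply: fil_sum => a _; have f1 : fil m.+1 a.+1 (jm m ^+ a).
  by rewrite -[_ ^+ _]mulr1 -[X in fil _ X]addn1; apply/fil_mull_jmX/fil_one.
have := fil_mul (fil_mono (leqnSn m) (leqnn _) (IH (k - a)%N (fun s => Q (nat_of_ord a :: s)))) f1.
by apply: fil_mono => //; have := ltn_ord a; lia.
Qed.

Lemma jm_evalS m k (Q : seq nat -> R) : jm_eval m.+1 k Q =
  \sum_(a < k.+1) jm_eval m (k - a) (fun s => Q (nat_of_ord a :: s)) * jm m ^+ a.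
Proof. by []. Qed.

Arguments jm_eval : simpl never.

Lemma fil_kappa_jm m j : fil m j.+1 (kappa_jm m j).
Proof.
elim: m j => [|m IH] j /=.
  by case: j => [|j]; [exact: fil_one | exact: fil_zero].
apply: fil_sum => g _; apply: fil_scale.
have := fil_mull_jmX g (ltnSn m) (fil_mono (leqnSn m) (leqnn _) (IH (j - g)%N)).
by apply: fil_mono => //; have := ltn_ord g; lia.
Qed.

Lemma big_triangle n (F : nat -> nat -> H) :
  \sum_(j < n) \sum_(g < j.+1) F j g = \sum_(g < n) \sum_(i < n - g) F (g + i)%N g.
Proof.
elim: n => [|n IH]; first by rewrite !big_ord0.
rewrite big_ord_recr IH [RHS]big_ord_recr /= subSnn big_ord1 addn0 big_ord_recr.
rewrite addrA -big_split; congr (_ + _); apply: eq_bigr => g _ /=.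
by rewrite subSn ?big_ord_recr /= ?subnKC // ltnW.
Qed.

Lemma big_triangle_swap n (F : nat -> nat -> H) :
  \sum_(i < n) \sum_(j < n - i) F i j = \sum_(j < n) \sum_(i < n - j) F i j.
Proof.
under eq_bigr do rewrite (big_ord_widen n) ?leq_subr //.
rewrite (exchange_big_dep predT) //; apply: eq_bigr => j _.
rewrite [RHS](big_ord_widen n (fun i => F i j)) ?leq_subr //.
by apply: eq_bigl => i; have := ltn_ord i; have := ltn_ord j; lia.
Qed.

(** On strand m the exponent c read by Phi and the power g taken from kappa combine to a = c + g,
    which is the exponent seen by [kmul]. The proof reindexes the sum over c, g and the amount i
    taken from the lower strands. *)
Lemma jm_eval_kmul m e (b : nat) (Phi : nat -> seq nat -> R) : (m <= N.+1)%N ->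
  \sum_(j < e.+1) jm_eval m (e - j) (Phi (b + j)%N) * kappa_jm m j =
  jm_eval m e (kmul xi Phi b).
Proof.
elim: m e b Phi => [|m IH] e b Phi le_m.
  rewrite big_ord_recl addn0 subn0 mulr1 big1 ?addr0 => [|j _]; last by rewrite mulr0.
  by [].
pose F c g i : H := kappa xi g *: (jm_eval m (e - (c + g + i))
  (fun s => Phi (b + g + i)%N (c :: s)) * kappa_jm m i * jm m ^+ (c + g)).
have cx d f : fil m d f -> GRing.comm (jm m) f by apply: fil_jm_comm => //; exact: ltnW.
transitivity (\sum_(j < e.+1) \sum_(g < j.+1) \sum_(c < (e - j).+1) F c g (j - g)%N).
  apply: eq_bigr => j _; rewrite jm_evalS /= mulr_sumr; apply: eq_bigr => g _.
  have le_g : (g <= j)%N by rewrite -ltnS.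
  rewrite -scalerAr mulr_suml scaler_sumr; apply: eq_bigr => c _; congr (_ *: _).
  rewrite mulrA -(mulrA _ (jm m ^+ c)) -exprD -!mulrA -addnA subnKC // -addnA subnKC //.
  rewrite [(c + j)%N]addnC subnDA; congr (_ * _).
  by apply/commr_sym/commrX/commr_sym/cx/fil_kappa_jm.
rewrite (big_triangle _ (fun j g => \sum_(c < (e - j).+1) F c g (j - g)%N)).
transitivity (\sum_(j < e.+1) \sum_(g < j.+1) \sum_(i < (e - j).+1) F (j - g)%N g i).
  rewrite (big_triangle _ (fun j g => \sum_(i < (e - j).+1) F (j - g)%N g i)).
  apply: eq_bigr => g _.
  transitivity (\sum_(i < e.+1 - g) \sum_(c < e.+1 - g - i) F c g i).
    apply: eq_bigr => i _; rewrite addKn.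
    by have -> : (e - (g + i)).+1 = (e.+1 - g - i)%N by have := ltn_ord i; lia.
  rewrite (big_triangle_swap _ (fun i c => F c g i)); apply: eq_bigr => i _; rewrite addKn.
  by have -> : (e - (g + i)).+1 = (e.+1 - g - i)%N by have := ltn_ord i; lia.
rewrite jm_evalS; apply: eq_bigr => a _.
rewrite [jm_eval m (e - a) _](jm_eval_sum m (e - a) a.+1 (kappa xi)
  (fun g s => kmul xi (fun d u => Phi d ((a - g)%N :: u)) (b + g) s)) mulr_suml.
apply: eq_bigr => g _; have le_g : (g <= a)%N by rewrite -ltnS.
rewrite -IH 1?ltnW // -scalerAl mulr_suml scaler_sumr; apply: eq_bigr => i _.
by rewrite /F subnK // subnDA.
Qed.

Lemma jm_eval_flat m k (S : nat -> seq nat -> R) :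
  \sum_(b < k.+1) jm_eval m.+1 (k - b) (S b) * jm m ^+ b =
  jm_eval m.+1 k (flat_state S).
Proof.
pose F (a b : nat) : H :=
  jm_eval m (k - a) (fun s => S b ((a - b)%N :: s)) * jm m ^+ a.
transitivity (\sum_(c < k.+1) \sum_(d < c.+1) F c d).
  rewrite big_triangle; apply: eq_bigr => b _; rewrite jm_evalS mulr_suml.
  have -> : (k.+1 - b = (k - b).+1)%N by have := ltn_ord b; lia.
  apply: eq_bigr => c _; rewrite /F addKn -mulrA -exprD addnC subnDA.
  by congr (_ * _); rewrite addnC.
rewrite jm_evalS; apply: eq_bigr => a _; rewrite /F -mulr_suml; congr (_ * _).
have := jm_eval_sum m (k - a) a.+1 (fun=> 1)
  (fun i s => S i ((nat_of_ord a - i)%N :: s)).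
under [RHS]eq_bigr do rewrite scale1r.
by move=> <-; apply: eq_jm_eval => s; apply: eq_bigr => i _; rewrite mul1r.
Qed.

Lemma jm_eval_top m k (Q : seq nat -> R) : (m <= N)%N ->
  \sum_(c < k.+2) jm_eval m.+1 (k.+1 - c) (fun s => Q (nat_of_ord c :: s)) *
     top_exp_gen m c =
  jm_eval m.+1 k (flat_state (top_state xi Q)).
Proof.
(* A linked strand with exponent 0 has expectation 0; this is why [top_state] reads Q only at
   positive heads. *)
move=> le_m; rewrite big_ord_recl {1}/top_exp_gen big_ord0 mulr0 add0r.
pose F (c d : nat) : H := jm_eval m.+1 (k - c) (fun s => Q (c.+1 :: s)) *
  kappa_jm m.+1 (c - d) * jm m ^+ d.
transitivity (\sum_(c < k.+1) \sum_(d < c.+1) F c d).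
  apply: eq_bigr => c _; rewrite /top_exp_gen subSS mulr_sumr.
  apply: eq_bigr => d _; rewrite /F -mulrA; congr (_ * _) => /=.
  have ck := @fil_jm_comm m.+1 m _ _ (le_m : (m.+1 <= N.+1)%N) le_m (fil_kappa_jm m.+1 (c - d)).
  by rewrite (commrX d (commr_sym ck)).
rewrite big_triangle -jm_eval_flat; apply: eq_bigr => d _; rewrite -jm_eval_kmul //.
rewrite mulr_suml; have -> : (k.+1 - d = (k - d).+1)%N by have := ltn_ord d; lia.
by apply: eq_bigr => c _; rewrite /F addKn subnDA.
Qed.

(** * Pairing with increasing elements *)

(** The head bit belongs to the last strand and tells whether a generator links it to the preceding
    one. Strand 0 has no predecessor, hence the condition [~~ last false bs] in what follows. *)
Fixpoint bit_elt (bs : bitseq) : H :=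
  if bs is b :: bs' then bit_elt bs' * (if b then t (size bs').-1 else 1) else 1.

Lemma gal_bit_elt bs : ~~ last false bs -> gal (size bs).-1 (bit_elt bs).
Proof.
elim: bs => [|b [|b' bs] IH] lb; first exact: gal_one.
  by case: b lb => //= _; rewrite mulr1; exact: gal_one.
apply: gal_mul; first exact: gal_mono (leq_pred _) (IH lb).
by case: b {lb}; [exact: gal_gen | exact: gal_one].
Qed.

Lemma tau_skip m c g u : (m <= N)%N -> gal m.-1 g -> gal m.-1 u ->
  tau (g * jm m ^+ c * u) = tau (g * exp_jm m c * u).
Proof.
case: m => [|m] le_m gg gu; first by rewrite expr0n.
by rewrite tauC mulrA tau_exp // -?mulrA 1?tauC -?mulrA //; apply: gal_mul.
Qed.

Lemma tau_take m c g u : (m < N)%N -> gal m g -> gal m u ->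
  GRing.comm g (exp_jm_gen m c) ->
  tau (g * jm m.+1 ^+ c * (u * t m)) = tau (g * exp_jm_gen m c * u).
Proof.
move=> lt_m gg gu cg.
have cu : GRing.comm (jm m.+1 ^+ c) u.
  exact/commr_sym/commrX/commr_sym/gal_jm_comm.
have -> : g * jm m.+1 ^+ c * (u * t m) = g * u * jm m.+1 ^+ c * t m.
  by rewrite mulrA -(mulrA g) cu mulrA.
by rewrite tau_exp_gen //; [rewrite tauC mulrA -cg | apply: gal_mul].
Qed.

(** A normal form that separates the powers of L_m from the lower strands, so that strand m can be
    integrated out. *)
Inductive fil_top (m d : nat) : H -> Prop :=
| fil_top_zero : fil_top m d 0
| fil_top_add a b of fil_top m d a & fil_top m d b : fil_top m d (a + b)
| fil_top_mul g e c of fil m e g & (e + c <= d)%N : fil_top m d (g * jm m ^+ c).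

Lemma fil_topP m d a : (m <= N)%N -> fil m.+1 d a -> fil_top m d a.
Proof.
move=> le_m; elim=> {d a} [d|d a b _ ta _ tb|d c a _ ta|d|d i a lt_i _ ta].
- exact: fil_top_zero.
- exact: fil_top_add.
- elim: ta => [|a1 a2 _ t1 _ t2|g e k fg le_d]; rewrite ?scaler0.
  + exact: fil_top_zero.
  + by rewrite scalerDr; apply: fil_top_add.
  + by rewrite scalerAl; apply: fil_top_mul le_d; apply: fil_scale.
- rewrite -[1]mulr1 -(expr0 (jm m)).
  by apply: (@fil_top_mul _ _ _ d.+1); rewrite ?addn0 //; exact: fil_one.
elim: ta => [|a1 a2 _ t1 _ t2|g e k fg le_d]; rewrite ?mulr0.
- exact: fil_top_zero.
- by rewrite mulrDr; apply: fil_top_add.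
have [->|ne_i] := eqVneq i m; last first.
  rewrite mulrA; apply: (@fil_top_mul _ _ _ e.+1); last by lia.
  by apply: fil_mull_jm fg; lia.
have cg : GRing.comm (jm m) g by apply: fil_jm_comm fg => //; exact: ltnW.
by rewrite mulrA cg -mulrA -exprS; apply: fil_top_mul fg _; rewrite addnS.
Qed.

Lemma exp_jm_gen_comm m e c g : (m <= N)%N -> fil m.+1 e g ->
  GRing.comm g (exp_jm_gen m c).
Proof.
move=> le_m; have fr := fil_exp_jm_gen m c.
have cj i : (i < m.+1)%N -> GRing.comm (exp_jm_gen m c) (jm i).
  move=> lt_i; apply: commr_sym; apply: fil_jm_comm fr => //; lia.
elim=> {e g} [d|d a b _ ga _ gb|d k a _ ga|d|d j a lt_j _ ga].
- exact/commr_sym/commr0.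
- by apply/commr_sym/commrD; exact: commr_sym.
- by rewrite /GRing.comm -scalerAl ga scalerAr.
- exact/commr_sym/commr1.
- by apply/commr_sym/commrM; [exact: cj | exact/commr_sym].
Qed.

Lemma bit_elt_cons b bs :
  bit_elt (b :: bs) = bit_elt bs * (if b then t (size bs).-1 else 1).
Proof. by []. Qed.

Lemma fil_gal_pred m d a : fil m d a -> gal m.-1 a.
Proof.
case: m => [|m]; last exact: fil_gal.
elim=> // {d a} [d|d a b _ ga _ gb|d k a _ ga|d].
- exact: gal_zero.
- exact: gal_add.
- exact: gal_scale.
- exact: gal_one.
Qed.

(** The bound d is strict, so d = 0 means zero. A linked strand lowers both d and the number of
    links by at least one and exactly one respectively; a skipped strand never raises d. *)
Lemma tau_fil_bits bs d a : (size bs <= N.+1)%N -> ~~ last false bs ->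
  fil (size bs) d a -> (d <= count id bs)%N -> tau (a * bit_elt bs) = 0.
Proof.
elim: bs d a => [|b bs IH] d a sz lb fa le_d.
  by move: le_d fa; rewrite leqn0 => /eqP -> /fil0_eq ->; rewrite mul0r linear0.
have lb' : ~~ last false bs by case: bs lb {IH sz fa le_d}.
have gu := gal_bit_elt lb'; have sz' : (size bs <= N.+1)%N by apply: ltnW.
elim: (fil_topP sz fa) => [|a1 a2 _ E1 _ E2|g e c fg le_ec].
- by rewrite mul0r linear0.
- by rewrite mulrDl linearD E1 E2 addr0.
have gg := fil_gal_pred fg; rewrite bit_elt_cons.
case: b sz lb fa le_d => sz lb fa le_d; last first.
  rewrite mulr1 tau_skip //; case: c le_ec => [|c] le_ec.
    rewrite exp_jm0 mulr1 (IH e) //.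
    by move: (count id bs) (le_d : (d <= count id bs)%N) => k; lia.
  apply: IH (fil_mul fg (fil_exp_jm _ c)) _ => //.
  by move: (count id bs) (le_d : (d <= count id bs)%N) => k; lia.
case: bs lb {IH} lb' gu sz' sz fa le_d fg gg (IH) => // b' bs _ lb' gu sz' sz fa le_d fg gg IH.
rewrite tau_take //; last exact: exp_jm_gen_comm fg.
apply: IH (fil_mul fg (fil_exp_jm_gen _ c)) _ => //.
by move: (count id _) (le_d : (d <= (count id (b' :: bs)).+1)%N) => k; lia.
Qed.

(** In the critical degree nothing can be spared. By [tau_fil_bits] a skipped strand contributes
    only with exponent 0, and on a linked strand [exp_jm_gen] may be replaced by its leading
    part. *)
Lemma tau_jm_eval_bits bs (Q : seq nat -> R) :
  (size bs <= N.+1)%N -> ~~ last false bs ->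
  tau (jm_eval (size bs) (count id bs) Q * bit_elt bs) = bit_value xi Q bs.
Proof.
elim: bs Q => [|b bs IH] Q sz lb.
  by rewrite /= mulr1 tauZ tau_one mulr1.
have lb' : ~~ last false bs by case: bs lb {IH sz}.
have gu := gal_bit_elt lb'; have sz' : (size bs <= N.+1)%N by apply: ltnW.
have fE k c := @fil_jm_eval (size bs) (k - c) (fun s => Q (c :: s)).
have gE k c := fil_gal_pred (fE k c).
rewrite bit_elt_cons; case: b sz lb => sz lb; last first.
  rewrite -[count id _]/(count id bs) mulr1 jm_evalS mulr_suml linear_sum.
  rewrite big_ord_recl big1 => [|i _].
    by rewrite expr0 mulr1 subn0 addr0 /= -IH.
  rewrite tau_skip //= /bump /=.
  apply: tau_fil_bits (fil_mul (fE _ _) (fil_exp_jm _ _)) _ => //.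
  by move: (count id bs) i => k i; have := ltn_ord i; lia.
case: bs lb IH lb' gu sz' sz fE gE => // b' bs _ IH lb' gu sz' sz fE gE.
rewrite -[count id (true :: _)]/(count id (b' :: bs)).+1.
rewrite -[bit_value _ _ (true :: _)]/(bit_value xi (flat_state (top_state xi Q)) (b' :: bs)).
rewrite jm_evalS mulr_suml linear_sum -IH // -jm_eval_top // mulr_suml linear_sum.
move Ek : (count id (b' :: bs)) => k; apply: eq_bigr => c _.
rewrite tau_take //; last exact: exp_jm_gen_comm (fE _ _).
apply/eqP; rewrite -subr_eq0 -linearB -mulrBl -mulrBr; apply/eqP.
case: c => -[|c] lt_c /=.
  have := top_exp_genP (size bs) 0; rewrite -[exp_jm_gen _ 0]/(0 : H) => /fil0_eq ->.
  by rewrite mulr0 mul0r linear0.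
apply: tau_fil_bits (fil_mul (fE _ _) (top_exp_genP _ _)) _ => //.
by rewrite Ek /=; move: lt_c; lia.
Qed.

Lemma size_bits_of_blocks c : 0%N \notin c -> size (bits_of_blocks c) = sumn c.
Proof.
elim: c => [|a c IH] //; rewrite inE negb_or => /andP[a_gt0 c0].
rewrite /bits_of_blocks /= size_cat size_rcons size_nseq -/(bits_of_blocks c) IH //.
by case: a a_gt0.
Qed.

Lemma count_bits_of_blocks c : count id (bits_of_blocks c) = block_weight c.
Proof.
elim: c => [|a c IH] //; rewrite /bits_of_blocks /= count_cat -/(bits_of_blocks c) IH.
by rewrite -cats1 count_cat count_nseq /= !addn0 mul1n.
Qed.

Lemma last_bits_of_blocks c : ~~ last false (bits_of_blocks c).
Proof.
elim: c => [|a c IH] //; rewrite /bits_of_blocks /= last_cat last_rcons.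
exact: IH.
Qed.

Definition gen_run (p l : nat) : H := \prod_(i <- iota p l) t i.

Lemma gen_run0 p : gen_run p 0 = 1. Proof. by rewrite /gen_run big_nil. Qed.

Lemma gen_runS p l : gen_run p l.+1 = gen_run p l * t (p + l).
Proof. by rewrite /gen_run -addn1 iotaD big_cat big_seq1. Qed.

Lemma gen_run_cons p l : gen_run p l.+1 = t p * gen_run p.+1 l.
Proof. by rewrite /gen_run big_cons. Qed.

Fixpoint block_elt (c : seq nat) : H :=
  if c is a :: c' then block_elt c' * gen_run (sumn c') a.-1 else 1.

Lemma bit_elt_blocks c : 0%N \notin c -> bit_elt (bits_of_blocks c) = block_elt c.
Proof.
elim: c => [|a c IH] //; rewrite inE negb_or => /andP[a_gt0 c0].
rewrite /bits_of_blocks /= -/(bits_of_blocks c) cat_rcons.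
elim: a.-1 => [|l IHl] /=; first by rewrite gen_run0 IH.
rewrite IHl gen_runS -mulrA size_cat size_nseq /= size_bits_of_blocks //.
by congr (_ * (_ * t _)); rewrite addnS /= addnC.
Qed.

Lemma tau_jm_eval_blocks c (Q : seq nat -> R) : 0%N \notin c ->
  (sumn c <= N.+1)%N -> zero_inv Q ->
  tau (jm_eval (sumn c) (block_weight c) Q * block_elt c) = block_value xi Q c.
Proof.
move=> c0 le_c zQ; rewrite -bit_value_blocks // -bit_elt_blocks //.
rewrite -tau_jm_eval_bits ?size_bits_of_blocks ?last_bits_of_blocks //.
by rewrite count_bits_of_blocks.
Qed.

Lemma tau_jm_eval_low c k (Q : seq nat -> R) : 0%N \notin c ->
  (sumn c <= N.+1)%N -> (k < block_weight c)%N ->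
  tau (jm_eval (sumn c) k Q * block_elt c) = 0.
Proof.
move=> c0 le_c lt_k; rewrite -bit_elt_blocks //.
apply: (@tau_fil_bits _ k.+1); rewrite ?size_bits_of_blocks ?last_bits_of_blocks //.
  exact: fil_jm_eval.
by rewrite count_bits_of_blocks.
Qed.

(** * Centrality of symmetric polynomials *)

Section SymmetricCommute.
Variables x y z : H.
Hypotheses (cxy : GRing.comm x y) (cD : GRing.comm z (x + y)).
Hypothesis cM : GRing.comm z (x * y).

Lemma comm_power_sum c : GRing.comm z (x ^+ c + y ^+ c).
Proof.
elim/ltn_ind: c => -[|[|c]] IH; first by rewrite !expr0; apply: commrD; exact: commr1.
  by rewrite !expr1.
have -> : x ^+ c.+2 + y ^+ c.+2 =
    (x + y) * (x ^+ c.+1 + y ^+ c.+1) - (x * y) * (x ^+ c + y ^+ c).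
  have E1 : x * y * x ^+ c = y * x ^+ c.+1 by rewrite cxy -mulrA -exprS.
  have E2 : x * y * y ^+ c = x * y ^+ c.+1 by rewrite -mulrA -exprS.
  rewrite [X in _ - X]mulrDr E1 E2 mulrDl !mulrDr -!exprS.
  by rewrite [X in _ + X - _]addrC addrACA [X in _ + X - _]addrC addrK.
by apply: commrB; apply: commrM => //; apply: IH.
Qed.

Lemma comm_monomial_sum c d : GRing.comm z (x ^+ c * y ^+ d + x ^+ d * y ^+ c).
Proof.
wlog le_cd : c d / (c <= d)%N => [th|].
  by case: (leqP c d) => [/th//|/ltnW/th]; rewrite addrC.
have cyx e f : GRing.comm (y ^+ e) (x ^+ f).
  by apply: commrX; apply/commr_sym; apply: commrX.
have -> : x ^+ c * y ^+ d + x ^+ d * y ^+ c =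
    (x * y) ^+ c * (x ^+ (d - c) + y ^+ (d - c)).
  rewrite exprMn_comm // mulrDr -{1 2}(subnKC le_cd) !exprD addrC.
  by congr (_ + _); rewrite -!mulrA // cyx.
by apply: commrM; [exact: commrX | exact: comm_power_sum].
Qed.

End SymmetricCommute.

(** Opposite terms cancel. The middle term needs its own hypothesis, since 2 may be a zero
    divisor. *)
Lemma big_diag_antisym n (F : nat -> nat -> H) :
  (forall i j, F j i = - F i j) -> (forall i, F i i = 0) ->
  \sum_(j < n.+1) F (n - j)%N j = 0.
Proof.
elim/ltn_ind: n F => -[|[|n]] IH F FN F0.
- by rewrite big_ord1 F0.
- by rewrite big_ord_recr big_ord1 /= FN addNr.
rewrite big_ord_recl big_ord_recr /= subn0 subnn FN addrCA addNr addr0.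
rewrite -[RHS](IH n _ (fun i j => F i.+1 j.+1)) //; apply: eq_bigr => j _.
by rewrite /bump /= add1n -subSn // -ltnS.
Qed.

Lemma big_triangle_antisym n (F : nat -> nat -> H) :
  (forall i j, F j i = - F i j) -> (forall i, F i i = 0) ->
  \sum_(i < n) \sum_(j < n - i) F i j = 0.
Proof.
move=> FN F0; rewrite (big_triangle_swap n (fun i j => F i j)).
transitivity (\sum_(j < n) \sum_(g < j.+1) F (j - g)%N g); last first.
  by rewrite big1 // => j _; apply: big_diag_antisym.
rewrite (big_triangle n (fun j g => F (j - g)%N g)).
by apply: eq_bigr => g _; apply: eq_bigr => i _; rewrite addKn.
Qed.

Definition sym_coef (Q : seq nat -> R) :=
  forall u c d v, Q (u ++ c :: d :: v) = Q (u ++ d :: c :: v).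

(** Only the strands i and i+1 interact with t_i. Grouped by their exponents, the coefficients are
    symmetric while the commutators of t_i with x^d y^c are antisymmetric in (c, d), so the sum
    cancels. *)
Lemma jm_eval_comm_gen m k (Q : seq nat -> R) i : sym_coef Q ->
  (i.+1 < m)%N -> (m <= N.+1)%N -> GRing.comm (t i) (jm_eval m k Q).
Proof.
elim: m k Q => [|m IH] k Q symQ // lt_i le_m; rewrite jm_evalS.
have [Em|ne_m] := eqVneq m i.+1; last first.
  apply: commr_sum => c _; apply: commrM.
    by apply: IH => [u d e v||]; [exact: (symQ (_ :: u)) | lia | exact: ltnW].
  by apply/commrX/jm_comm_gen => //; lia.
subst m; pose f c d := jm_eval i (k - (c + d)) (fun s => Q (c :: d :: s)).
have fC c d : f c d = f d c.
  by rewrite /f addnC; apply: eq_jm_eval => s; apply: (symQ [::]).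
have cf c d : GRing.comm (t i) (f c d).
  have: fil i (k - (c + d)).+1 (f c d) by exact: fil_jm_eval.
  elim=> {c d} [d|d a b _ ga _ gb|d c a _ ga|d|d j a lt_j _ ga].
  - exact: commr0.
  - exact: commrD.
  - by rewrite /GRing.comm -scalerAr ga scalerAl.
  - exact: commr1.
  - by apply: commrM => //; apply: jm_comm_gen; lia.
pose x := jm i; pose y := jm i.+1.
have le_i : (i < N)%N by [].
pose F c d := t i * (x ^+ d * y ^+ c) - (x ^+ d * y ^+ c) * t i.
have cxy : GRing.comm x y by apply: jm_comm => //; exact: ltnW.
have Eyt := jm_mul_gen le_i; have Ety := gen_mul_jm le_i.
have cM : GRing.comm (t i) (x * y).
  rewrite /GRing.comm cxy mulrA Ety -cxy -[RHS]mulrA Eyt !(mulrDl, mulrDr) mul1r mulr1.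
  by rewrite !mulrA -scalerAl -scalerAr cxy.
have key c d : GRing.comm (t i) (x ^+ d * y ^+ c + x ^+ c * y ^+ d).
  apply: comm_monomial_sum => //.
  rewrite /GRing.comm mulrDr mulrDl Ety Eyt !addrA; congr (_ + _ + _).
  by rewrite addrC.
apply/eqP; rewrite -subr_eq0 mulr_sumr mulr_suml -sumrB; apply/eqP.
rewrite -[RHS](@big_triangle_antisym k.+1 (fun c d => f c d * F c d)); last first.
- by move=> c; rewrite /F -exprMn_comm // (commrX c cM) subrr mulr0.
- move=> c d; rewrite fC -mulrN; congr (_ * _); apply/eqP.
  rewrite -addr_eq0 /F addrACA -opprD -mulrDr -mulrDl.
  by rewrite subr_eq0; apply/eqP/key.
apply: eq_bigr => c _; rewrite jm_evalS mulr_suml mulr_sumr mulr_suml -sumrB.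
have -> : (k.+1 - c = (k - c).+1)%N by have := ltn_ord c; lia.
apply: eq_bigr => d _; rewrite /F mulrBr.
by rewrite -subnDA -/(f c d) -/x -/y !mulrA -cf.
Qed.

Lemma jm_eval_comm k (Q : seq nat -> R) a : sym_coef Q -> gal N a ->
  GRing.comm (jm_eval N.+1 k Q) a.
Proof.
move=> symQ; apply: gal_comm => i lt_i.
exact/commr_sym/jm_eval_comm_gen.
Qed.

(** * Trace functions and increasing elements *)

(* Modulo commutators, gal (m+1) = gal m + gal m t_m gal m is spanned by
   gal m and gal m t_m. *)
Lemma trace_eq0 (phi : {scalar H}) :
  (forall a b, phi (a * b) = phi (b * a)) ->
  (forall s, sorted ltn s -> all (gtn N) s -> phi (\prod_(i <- s) t i) = 0) ->
  forall a, gal N a -> phi a = 0.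
Proof.
move=> phiC phi0.
have phiZ (c : R) a : phi (c *: a) = c * phi a by exact: linearZ.
suff key m s a : (m <= N)%N -> sorted ltn s ->
    all (fun i => (m <= i < N)%N) s -> gal m a -> phi (a * \prod_(i <- s) t i) = 0.
  by move=> a ga; have := key N [::] a; rewrite big_nil mulr1; apply.
elim: m s a => [|m IH] s a le_m ss als.
  by case/gal0=> c ->; rewrite -scalerAl mul1r phiZ phi0 ?mulr0.
move=> ga; elim: (gal_splitP le_m ga) => [b gb|b1 b2 _ E1 _ E2|b1 b2 g1 g2].
- apply: IH => //; first exact: ltnW.
  by apply/allP => i /(allP als) /andP[lt_m ->]; rewrite ltnW.
- by rewrite mulrDl linearD E1 E2 addr0.
have cb : GRing.comm b2 (\prod_(i <- s) t i).
  rewrite big_seq; apply: commr_prod => i /(allP als) /andP[lt_m _].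
  exact/commr_sym/gal_comm_gen/g2.
rewrite -(mulrA (b1 * _)) cb mulrA phiC -(mulrA b1) (mulrA b2).
have -> : t m * \prod_(i <- s) t i = \prod_(i <- m :: s) t i by rewrite big_cons.
apply: IH => //; first exact: ltnW.
- rewrite /= path_sortedE ?ss ?andbT; last exact: ltn_trans.
  by apply/allP => i /(allP als) /andP[].
- rewrite /= leqnn le_m; apply/allP => i /(allP als) /andP[lt_m ->].
  by rewrite ltnW.
- exact: gal_mul.
Qed.

Lemma eq_perm_of_swap (f : seq nat -> R) :
  (forall u c d v, f (u ++ c :: d :: v) = f (u ++ d :: c :: v)) ->
  forall s s', perm_eq s s' -> f s = f s'.
Proof.
move=> fS; have front u c w v : f (u ++ c :: w ++ v) = f (u ++ w ++ c :: v).
  elim: w u => [|d w IH] u //=; rewrite fS.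
  by rewrite -cat_rcons IH cat_rcons.
suff key u s s' : perm_eq s s' -> f (u ++ s) = f (u ++ s') by move=> s s' /(key [::]).
elim: s u s' => [|c s IH] u s' pss'.
  by rewrite perm_sym in pss'; rewrite (perm_nilP pss').
have cs' : c \in s' by rewrite -(perm_mem pss') mem_head.
case/splitPr: cs' pss' => w v pss'.
rewrite -front -!cat_rcons; apply: IH.
by rewrite -(perm_cons c) (perm_trans pss') // -cat1s -[_ :: w ++ v]cat1s perm_catCA.
Qed.

(* The positive braid that passes the block of d strands starting at p across
   the next e strands. *)
Fixpoint block_braid (p d e : nat) : H :=
  if e is e'.+1 then gen_run (p + e') d * block_braid p d e' else 1.

Lemma comm_gen_run (z : H) p l : (forall i, (p <= i < p + l)%N -> GRing.comm z (t i)) ->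
  GRing.comm z (gen_run p l).
Proof.
move=> cz; rewrite /gen_run big_seq; apply: commr_prod => i.
by rewrite mem_iota; apply: cz.
Qed.

Lemma gen_run_shift p l j : (p <= j)%N -> (j.+1 < p + l)%N -> (p + l <= N)%N ->
  gen_run p l * t j = t j.+1 * gen_run p l.
Proof.
elim: l => [|l IH] le_j lt_j le_N; first by lia.
rewrite gen_runS; have [lt_jl|ge_jl] := ltnP j.+1 (p + l).
  by rewrite -mulrA -tC // mulrA IH ?mulrA //; lia.
case: l IH lt_j le_N ge_jl => [|l] IH lt_j le_N ge_jl; first by lia.
have -> : (p + l.+1 = j.+1)%N by lia.
have Ej : (p + l = j)%N by lia.
rewrite gen_runS Ej -!mulrA (mulrA (t j)) tB; last by lia.
rewrite !mulrA; congr (_ * _ * _).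
by apply/esym/comm_gen_run => i ri; apply/esym/tC; lia.
Qed.

Lemma gen_run_pair q l : (q.+1 + l <= N)%N ->
  gen_run q.+1 l * gen_run q l * t (q + l) = t q * (gen_run q.+1 l * gen_run q l).
Proof.
elim: l => [|l IH] le_N; first by rewrite !gen_run0 !mul1r mulr1 addn0.
rewrite !gen_runS addSn addnS; set u := t (q + l); set v := t (q + l).+1.
have cv : GRing.comm v (gen_run q l).
  by apply: comm_gen_run => i ri; apply/esym/tC; lia.
have E : gen_run q.+1 l * v * (gen_run q l * u) =
    gen_run q.+1 l * gen_run q l * (v * u).
  by rewrite -!mulrA (mulrA v) cv -!mulrA.
rewrite E -(mulrA _ _ v) -tB; last by lia.
by rewrite !mulrA IH ?mulrA //; lia.
Qed.

Lemma block_braid_comm p d e (z : H) :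
  (forall i, (p <= i)%N -> (i.+1 < p + d + e)%N -> GRing.comm z (t i)) ->
  GRing.comm z (block_braid p d e).
Proof.
elim: e => [|e IH] cz /=; first exact: commr1.
apply: commrM; first by apply: comm_gen_run => i ri; apply: cz; lia.
by apply: IH => i le_i lt_i; apply: cz; lia.
Qed.

Lemma block_braid_left p d e j : (p <= j)%N -> (j.+1 < p + d)%N ->
  (p + d + e <= N.+1)%N -> block_braid p d e * t j = t (j + e) * block_braid p d e.
Proof.
move=> le_j lt_j; elim: e => [|e IH] le_N /=; first by rewrite mul1r mulr1 addn0.
rewrite -mulrA IH; last by lia.
by rewrite mulrA gen_run_shift ?mulrA ?addnS //; lia.
Qed.

Lemma block_braid_right p d e j : (j.+1 < e)%N -> (p + d + e <= N.+1)%N ->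
  block_braid p d e * t (p + d + j) = t (p + j) * block_braid p d e.
Proof.
elim: e => [|e IH] // lt_j le_N; rewrite /=.
have [lt_je|ge_je] := ltnP j.+1 e.
  rewrite -mulrA IH //; last by lia.
  rewrite !mulrA; congr (_ * _); apply/esym/comm_gen_run => i ri.
  by apply: tC; lia.
case: e IH lt_j le_N ge_je => [|e] _ lt_j le_N ge_je; first by lia.
have Ej : j = e by lia.
rewrite {j lt_j ge_je}Ej /=; have ct : GRing.comm (t (p + d + e)) (block_braid p d e).
  by apply: block_braid_comm => i le_i lt_i; apply/esym/tC; lia.
rewrite -!mulrA -ct addnS addnAC !mulrA gen_run_pair ?mulrA //; lia.
Qed.

Definition invertible (z : H) := exists2 y, y * z = 1 & z * y = 1.

Lemma invertible_mul y z : invertible y -> invertible z -> invertible (y * z).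
Proof.
move=> [y' l1 r1] [z' l2 r2]; exists (z' * y').
  by rewrite mulrA -(mulrA z') l1 mulr1.
by rewrite mulrA -(mulrA y) r2 mulr1.
Qed.

Lemma invertible_gen i : (i < N)%N -> invertible (t i).
Proof.
move=> lt_i; exists (t i - xi%:A).
  by rewrite mulrBl tt // -scalerAl mul1r addrK.
by rewrite mulrBr tt // -scalerAr mulr1 addrK.
Qed.

Lemma invertible_block_braid p d e : (p + d + e <= N.+1)%N ->
  invertible (block_braid p d e).
Proof.
have inv1 : invertible 1 by exists 1; rewrite mul1r.
elim: e => [|e IH] le_N //=; apply: invertible_mul; last by apply: IH; lia.
rewrite /gen_run big_seq; elim/big_ind: _ => // [y z|i]; first exact: invertible_mul.
by rewrite mem_iota => ri; apply: invertible_gen; lia.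
Qed.

Lemma run_intertwine (z : H) p q l :
  (forall i, (i < l)%N -> z * t (p + i) = t (q + i) * z) ->
  z * gen_run p l = gen_run q l * z.
Proof.
elim: l => [|l IH] tw; first by rewrite !gen_run0 mulr1 mul1r.
rewrite !gen_runS mulrA IH => [|i lt_i]; last by apply: tw; apply: ltnW.
by rewrite -!mulrA tw.
Qed.

Lemma block_elt_comm c i : (sumn c <= i)%N -> GRing.comm (t i) (block_elt c).
Proof.
elim: c => [|a c IH] /= le_i; first exact: commr1.
apply: commrM; first by apply: IH; lia.
by apply: comm_gen_run => j rj; apply/esym/tC; lia.
Qed.

(** The factor U of the blocks u depends on w only through its size n, so it is the same for both
    orders of the two blocks exchanged in [trace_block_swap]. *)
Lemma block_elt_cat u n : exists2 U,
  forall z, (forall i, (n <= i)%N -> GRing.comm z (t i)) -> GRing.comm z U &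
  forall w, sumn w = n -> block_elt (u ++ w) = block_elt w * U.
Proof.
elim: u => [|a u [U cU EU]].
  by exists 1 => [z _|w _]; [exact: commr1 | rewrite mulr1].
exists (U * gen_run (sumn u + n) a.-1) => [z cz|w Ew] /=.
  apply: commrM; first exact: cU.
  by apply: comm_gen_run => i ri; apply: cz; lia.
by rewrite EU // sumn_cat Ew mulrA.
Qed.

(** The positive braid X that passes one block across the other commutes with everything below and
    above, and carries each generator of a block to the matching generator of the moved block. So X
    conjugates one element into the other. *)
Lemma trace_block_swap (phi : {scalar H}) u d e v :
  (forall a b, phi (a * b) = phi (b * a)) ->
  (sumn (u ++ d :: e :: v) <= N.+1)%N ->
  phi (block_elt (u ++ d :: e :: v)) = phi (block_elt (u ++ e :: d :: v)).
Proof.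
move=> phiC le_N; pose p := sumn v.
have le_pde : (p + d + e <= N.+1)%N.
  by move: le_N; rewrite sumn_cat /= -/p; lia.
have [U cU EU] := block_elt_cat u (p + d + e).
rewrite !EU /= -/p; [|lia|lia].
pose X := block_braid p e d.
have [Y YX XY] : invertible X by apply: invertible_block_braid; lia.
have cXt i : (p + d + e <= i)%N -> GRing.comm X (t i).
  move=> le_i; apply/commr_sym/block_braid_comm => j le_j lt_j.
  by apply/esym/tC; lia.
have cXU : GRing.comm X U by apply: cU.
have cXv : GRing.comm X (block_elt v).
  apply/commr_sym/block_braid_comm => i le_i _.
  exact/commr_sym/block_elt_comm.
have EX : X * (gen_run p e.-1 * gen_run (e + p) d.-1) =
    gen_run p d.-1 * gen_run (d + p) e.-1 * X.
  rewrite mulrA (@run_intertwine X p (d + p)) => [|i lt_i]; last first.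
    by rewrite block_braid_left //; [congr (t _ * _); lia | lia | lia | lia].
  rewrite -mulrA (@run_intertwine X (e + p) p) => [|i lt_i]; last first.
    by rewrite [(e + p)%N]addnC block_braid_right //; lia.
  rewrite !mulrA; congr (_ * _); apply: comm_gen_run => i ri.
  by apply/commr_sym/comm_gen_run => j rj; apply: tC; lia.
rewrite -[X in phi (X * _)]mul1r -YX.
transitivity (phi (Y * (block_elt v * gen_run p d.-1 * gen_run (d + p) e.-1 * U) * X)).
  congr (phi _); rewrite -!mulrA; congr (_ * _).
  rewrite (mulrA X (block_elt v)) cXv -!mulrA; congr (_ * _).
  by rewrite (mulrA (gen_run p e.-1)) mulrA EX -cXU !mulrA.
by rewrite phiC !mulrA XY mul1r.
Qed.

Lemma trace_block_perm (phi : {scalar H}) c c' :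
  (forall a b, phi (a * b) = phi (b * a)) -> (sumn c <= N.+1)%N ->
  perm_eq c c' -> phi (block_elt c) = phi (block_elt c').
Proof.
move=> phiC le_N pcc'.
pose f s := if (sumn s <= N.+1)%N then phi (block_elt s) else 0.
have: f c = f c'.
  apply: eq_perm_of_swap pcc' => u d e v; rewrite /f !sumn_cat /= (addnCA d).
  case: ifP => // le_s; apply: trace_block_swap => //.
  by move: le_s; rewrite sumn_cat /=; lia.
by rewrite /f -(perm_sumn pcc') le_N.
Qed.

Fixpoint upward_elt (p : nat) (c : seq nat) : H :=
  if c is a :: c' then gen_run p a.-1 * upward_elt (p + a) c' else 1.

Lemma upward_elt_rcons p c a :
  upward_elt p (rcons c a) = upward_elt p c * gen_run (p + sumn c) a.-1.
Proof.
elim: c p => [|d c IH] p /=; first by rewrite mulr1 mul1r addn0.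
by rewrite IH mulrA addnA.
Qed.

Lemma block_elt_rev c : block_elt (rev c) = upward_elt 0 c.
Proof.
elim/last_ind: c => [|c a IH] //.
by rewrite rev_rcons upward_elt_rcons /= IH sumn_rev.
Qed.

(** The fourth conjunct drives the induction: a letter put in front extends the first run exactly
    when the first block already has more than one strand. *)
Lemma word_blocks n p s : sorted ltn s -> all (fun i => (p <= i < p + n)%N) s ->
  exists c : seq nat, [/\ 0%N \notin c, sumn c = n.+1,
    run_lengths s = [seq x <- map predn c | x != 0%N],
    (1 < head 0%N c)%N = (ohead s == Some p) &
    upward_elt p c = \prod_(i <- s) t i].
Proof.
elim: n p s => [|n IH] p s ss als.
  exists [:: 1%N]; case: s ss als => [|i s] _ /=; last by case/andP; lia.
  by rewrite big_nil gen_run0 mulr1.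
have in_tail s' : all (fun i => (p <= i < p + n.+1)%N) s' -> p \notin s' ->
    all (fun i => (p.+1 <= i < p.+1 + n)%N) s'.
  move=> als' ps'; apply/allP => i is'; have := allP als' i is'.
  by have : i != p by [apply: contraNneq ps' => <-]; lia.
have [ps|ps] := boolP (ohead s == Some p).
  case: s ss als ps => // i s ss /andP[_ als] /eqP[Ei]; rewrite {i}Ei in ss *.
  have ps : p \notin s.
    apply/negP => ps; have := allP (order_path_min ltn_trans ss) p ps.
    by rewrite /= ltnn.
  have [c [c0 Ec Er Eh Ep]] := IH p.+1 s (path_sorted ss) (in_tail s als ps).
  case: c c0 Ec Er Eh Ep => [|a c] // + Ec Er Eh Ep; rewrite inE negb_or => /andP[a_gt0 c0].
  exists (a.+1 :: c); split=> //.
  - by rewrite /= addSn -Ec.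
  - rewrite /= -Eh Er /=; case: a a_gt0 {Ec Er Eh Ep} => // -[|a] _ //=.
  - by case: a a_gt0 {Ec Er Eh Ep}; rewrite //= eqxx.
  - rewrite /= big_cons -Ep /=; case: a a_gt0 {Ec Er Eh Ep} => // a _.
    by rewrite gen_run_cons -!mulrA addSnnS.
have ps' : p \notin s.
  case: s ss als ps => // i s ss /andP[/andP[le_i _] _] ps; rewrite inE negb_or.
  apply/andP; split; first by apply: contraNneq ps => ->.
  apply/negP => ip; have := allP (order_path_min ltn_trans ss) p ip => /=; lia.
have [c [c0 Ec Er Eh Ep]] := IH p.+1 s ss (in_tail s als ps').
exists (1%N :: c); split=> //=; first by rewrite add1n Ec.
by rewrite gen_run0 mul1r addn1.
Qed.

Lemma sorted_word_blocks s : sorted ltn s -> all (gtn N) s ->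
  exists c : seq nat, [/\ 0%N \notin c, sumn c = N.+1,
    perm_eq (run_lengths s) [seq x <- map predn c | x != 0%N] &
    block_elt c = \prod_(i <- s) t i].
Proof.
move=> ss als; have [//|c [c0 Ec Er _ Ep]] := @word_blocks N 0 s ss.
exists (rev c); split; rewrite ?mem_rev ?sumn_rev ?block_elt_rev //.
by rewrite map_rev filter_rev Er perm_sym perm_rev.
Qed.

Lemma trace_eq0_blocks (phi : {scalar H}) :
  (forall a b, phi (a * b) = phi (b * a)) ->
  (forall c, 0%N \notin c -> sumn c = N.+1 -> phi (block_elt c) = 0) ->
  forall a, gal N a -> phi a = 0.
Proof.
move=> phiC phi0; apply: trace_eq0 => // s ss als.
by have [c [c0 Ec _ <-]] := sorted_word_blocks ss als; apply: phi0.
Qed.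

End HeckeRelations.

Ltac case_ifs := repeat match goal with |- context [if ?b then _ else _] =>
  lazymatch b with context [if _ then _ else _] => fail
  | _ => case: (boolP b) => ? end end; lia.

(** * The Hecke algebra of the symmetric group *)

Lemma val_sref n (i : 'I_n.-1) (x : 'I_n) :
  val (sref i x) = (if x == i :> nat then i.+1 else if x == i.+1 :> nat then val i else x)%N.
Proof.
rewrite /sref; case: tpermP => [->|->|/eqP xl /eqP xr] /=; rewrite ?eqxx //.
  by case: eqP => //; lia.
by move: xl xr; rewrite -!val_eqE /= => /negbTE-> /negbTE->.
Qed.

Lemma srefV n (i : 'I_n.-1) : ((sref i)^-1 = sref i)%g.
Proof. exact: tpermV. Qed.

Section HeckeGenerators.
Variable N : nat.
Local Notation n := N.+1.
Implicit Types (w : 'S_n) (i j : 'I_n.-1).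
Local Notation T := (@heckeT n).

Lemma heckeT_up w i : ~~ dr i w -> T w * T (sref i) = T (w * sref i)%g.
Proof. by rewrite heckeT_mulS -/(dr i w) => /negbTE->. Qed.

Lemma heckeT_upl w i : ~~ dl i w -> T (sref i) * T w = T (sref i * w)%g.
Proof.
move=> ndl; have E : coxlen (wprod (i :: redword w)) = size (i :: redword w).
  rewrite wprod_cons redwordK -[size _]/(size (redword w)).+1 size_redword -coxlenV invMg srefV.
  by rewrite coxlen_up ?coxlenV // drV invgK.
have E' : coxlen (wprod (redword w)) = size (redword w) by rewrite redwordK size_redword.
by move: (heckeT_reduced E); rewrite big_cons -(heckeT_reduced E') wprod_cons !redwordK.
Qed.

Lemma heckeT_sref_sq i : T (sref i) * T (sref i) = 1 + xi *: T (sref i).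
Proof.
rewrite heckeT_mulS sref2 coxlen1 ifT // -[sref i]mul1g coxlen_up //.
by rewrite drE invg1 !perm1 /= -leqNgt leqnSn.
Qed.

(** The default value 1 makes distant generators commute for all indices, as the relations of the
    preceding section demand. *)
Definition hgen (m : nat) : hecke n :=
  if insub m is Some i then T (sref (i : 'I_n.-1)) else 1.

Lemma hgenE m (lt_m : (m < N)%N) : hgen m = T (sref (Ordinal lt_m : 'I_n.-1)).
Proof. by rewrite /hgen insubT. Qed.

Lemma hgen_ord i : hgen i = T (sref i).
Proof. by rewrite /hgen valK. Qed.

Lemma hgen_sq m : (m < N)%N -> hgen m * hgen m = 1 + xi *: hgen m.
Proof. by move=> lt_m; rewrite hgenE; apply: heckeT_sref_sq. Qed.

Lemma hgenC l m : (l.+1 < m)%N -> hgen l * hgen m = hgen m * hgen l.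
Proof.
move=> lt_lm; have [lt_m|] := ltnP m N; last first.
  by move=> le_m; rewrite {2 3}/hgen insubN -?leqNgt // mulr1 mul1r.
have lt_l : (l < N)%N by lia.
rewrite !hgenE !heckeT_up; try by rewrite drE !srefV !val_sref /=; case_ifs.
by congr T; apply/permP => x; apply: val_inj; rewrite !permM !val_sref /=; case_ifs.
Qed.

Lemma hgen_braid m : (m.+1 < N)%N ->
  hgen m * hgen m.+1 * hgen m = hgen m.+1 * hgen m * hgen m.+1.
Proof.
move=> lt_m1; have lt_m : (m < N)%N by exact: ltnW.
rewrite !hgenE !heckeT_up;
  try by rewrite drE ?invMg !srefV ?permM !val_sref /=; case_ifs.
by congr T; apply/permP => x; apply: val_inj; rewrite !permM !val_sref /=; case_ifs.
Qed.

End HeckeGenerators.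

Lemma val_tperm n (a b x : 'I_n) :
  val (tperm a b x) = (if x == a :> nat then val b else if x == b :> nat then val a else val x).
Proof.
case: tpermP => [->|->|/eqP xa /eqP xb] /=; rewrite ?eqxx //.
  by case: eqP => // /ord_inj->.
by move: xa xb; rewrite -!val_eqE /= => /negbTE-> /negbTE->.
Qed.

Section HeckeTrace.
Variable N : nat.
Local Notation n := N.+1.
Implicit Types (w v : 'S_n) (i j : 'I_n.-1) (a b : hecke n).
Local Notation T := (@heckeT n).
Local Notation t := (@hgen N).

Lemma jm_jucys_murphy m (lt_m : (m < n)%N) :
  jm t m = jucys_murphy (Ordinal lt_m).
Proof.
elim: m lt_m => [|m IH] lt_m; first by rewrite /jucys_murphy big_pred0.
have lt_m' : (m < n)%N by apply: ltnW.
rewrite [LHS]/= (IH lt_m') /jucys_murphy mulr_sumr mulr_suml.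
rewrite [RHS](bigD1 (Ordinal lt_m')) //= addrC; congr (_ + _); last first.
  rewrite (hgenE (lt_m : (m < N)%N)); congr T; rewrite /sref; congr tperm; exact: val_inj.
apply: eq_big => [j|j lt_j]; first by rewrite -val_eqE /=; lia.
rewrite (hgenE (lt_m : (m < N)%N)) -mulrA heckeT_up; last first.
  by rewrite drE tpermV !val_tperm /=; case_ifs.
rewrite heckeT_upl; last by rewrite dlE !permM !val_sref !val_tperm /=; case_ifs.
congr T; apply/permP => x; apply: val_inj.
by rewrite !permM !(val_sref, val_tperm) /=; case_ifs.
Qed.

Lemma coef_involution (F : hecke n -> hecke n) (g : 'S_n -> 'S_n) (c : 'S_n -> Zxi) :
  linear F -> involutive g -> (forall w, F (T w) = T (g w) + c w *: T w) ->
  forall a v, F a v = a (g v) + c v * a v.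
Proof.
move=> linF gK FT a v; rewrite (lin_sum linF) sum_ffunE.
transitivity (\sum_w (a w * (v == g w)%:R + a w * c w * (v == w)%:R)).
  by apply: eq_bigr => w _; rewrite FT scalerDr !ffunE -mulrA.
rewrite big_split /= (bigD1 (g v)) //= gK eqxx mulr1 big1 ?addr0 => [|w ne]; last first.
  by rewrite -[v]gK (inj_eq (inv_inj gK)) eq_sym (negbTE ne) mulr0.
rewrite (bigD1 v) //= eqxx mulr1 big1 ?addr0 => [|w ne]; first by rewrite mulrC.
by rewrite eq_sym (negbTE ne) mulr0.
Qed.

Lemma mul_sref_coef a i v :
  (a * T (sref i)) v = a (v * sref i)%g + (xi *+ dr i v) * a v.
Proof.
rewrite hecke_mulS.
apply: (coef_involution (F := rmulS i) (g := fun w => (w * sref i)%g) (c := fun w => xi *+ dr i w)).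
- exact: rmulS_linear.
- by move=> w; rewrite srefKr.
- exact: rmulST.
Qed.

Lemma heckeT_mulSl w i :
  T (sref i) * T w = T (sref i * w)%g + (xi *+ dl i w) *: T w.
Proof.
have [dw|ndw] := boolP (dl i w); last by rewrite heckeT_upl // mulr0n scale0r addr0.
have ndw : ~~ dl i (sref i * w)%g by rewrite dl_flip dw.
have E : T (sref i) * T (sref i * w)%g = T w by rewrite heckeT_upl // srefK.
by rewrite -{1}E mulrA heckeT_sref_sq mulrDl mul1r -scalerAl E mulr1n.
Qed.

Lemma sref_mul_coef a i v :
  (T (sref i) * a) v = a (sref i * v)%g + (xi *+ dl i v) * a v.
Proof.
apply: (coef_involution (F := *%R (T (sref i))) (g := fun w => (sref i * w)%g)
  (c := fun w => xi *+ dl i w)).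
- by move=> k b c; rewrite mulrDr scalerAr.
- by move=> w; rewrite srefK.
- exact: (heckeT_mulSl^~ i).
Qed.

Definition htau (a : hecke n) : Zxi := a 1%g.

Lemma htau_linear : scalar htau.
Proof. by move=> k a b; rewrite /htau !ffunE. Qed.

HB.instance Definition _ :=
  GRing.isLinear.Build Zxi (hecke n) Zxi *%R htau htau_linear.

Lemma dr1 i : dr i 1%g = false.
Proof. by rewrite drE invg1 !perm1 /= ltnNge leqnSn. Qed.

Lemma gal_heckeT w : gal t N (T w).
Proof.
rewrite -(redwordK w) heckeT_reduced ?redwordK ?size_redword //.
elim: (redword w) => [|i r IH]; first by rewrite big_nil; apply: gal_one.
rewrite big_cons; apply: gal_mul IH.
by rewrite -hgen_ord; apply: gal_gen; apply: (ltn_ord i).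
Qed.

Lemma gal_hecke a : gal t N a.
Proof.
by rewrite (hecke_sum a); apply: gal_sum => w _; apply/gal_scale/gal_heckeT.
Qed.

Lemma htau_mul_hgen m (lt_m : (m < N)%N) a :
  htau (a * t m) = a (sref (Ordinal lt_m : 'I_n.-1)).
Proof. by rewrite (hgenE lt_m) /htau mul_sref_coef dr1 mul0r addr0 mul1g. Qed.

(** It suffices to move one generator at a time, and multiplying by T_s on either side brings the
    coefficient of s to the identity. *)
Lemma htauC a b : htau (a * b) = htau (b * a).
Proof.
elim: (gal_hecke b) a => [|b1 b2 _ E1 _ E2|c b1 _ E1|b1 m lt_m _ E1] a.
- by rewrite mulr1 mul1r.
- by rewrite mulrDl mulrDr !linearD /= E1 E2.
- by rewrite -scalerAl -scalerAr !linearZ /= E1.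
transitivity (htau (t m * (a * b1))).
  rewrite [in LHS]mulrA htau_mul_hgen hgenE /htau sref_mul_coef mulg1.
  by rewrite /dl mulg1 coxlen1 mul0r addr0.
by rewrite mulrA E1 mulrA.
Qed.

Lemma htau1 : htau 1 = 1.
Proof. by rewrite -heckeT1 /htau ffunE eqxx. Qed.

Lemma gal_support m a v (x : 'I_n) : gal t m a -> (m < x)%N -> v x != x -> a v = 0.
Proof.
move=> ga lt_m; elim: ga v => [|b1 b2 _ E1 _ E2|c b1 _ E1|b1 i lt_i _ E1] v vx.
- by rewrite -heckeT1 ffunE; case: (eqVneq v 1%g) vx => [->|]; rewrite ?perm1 ?eqxx //.
- by rewrite ffunE E1 ?E2 ?addr0.
- by rewrite ffunE E1 ?scaler0.
have lt_iN : (i < N)%N by apply: leq_trans lt_i _; rewrite -ltnS (ltn_trans lt_m).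
rewrite (hgenE lt_iN) mul_sref_coef (E1 v vx) mulr0 addr0 E1 //.
apply: contraNneq vx => /(congr1 (sref (Ordinal lt_iN : 'I_n.-1))).
rewrite -permM srefKr => ->; apply/eqP/val_inj; rewrite val_sref /=; case_ifs.
Qed.

Lemma htau_gal m a : (m < N)%N -> gal t m a -> htau (a * t m) = 0.
Proof.
move=> lt_m ga; rewrite htau_mul_hgen.
apply: (gal_support ga (x := sright (Ordinal lt_m : 'I_n.-1))) => //=.
by rewrite -val_eqE /sref tpermR /=; lia.
Qed.

Lemma htau_heckeT w a : htau (T w * a) = a (w^-1)%g.
Proof.
have Er : coxlen (wprod (redword w)) = size (redword w) by rewrite redwordK size_redword.
rewrite -(redwordK w); elim/last_ind: (redword w) Er a => [|r i IH] E a.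
  by rewrite /wprod big_nil invg1 heckeT1 mul1r.
have Er : coxlen (wprod r) = size r.
  by move: E; rewrite wprod_rcons size_rcons;
    have := coxlen_word r; have := coxlen_le_rcons i (wprod r); lia.
have ndr : dr i (wprod r) = false by rewrite /dr -wprod_rcons E size_rcons Er; lia.
rewrite wprod_rcons -heckeT_up ?ndr // -mulrA IH // sref_mul_coef.
by rewrite -drV ndr mul0r addr0 invMg srefV.
Qed.

Lemma hecke_form_heckeT w a : hecke_form (T w) a = a (w^-1)%g.
Proof.
rewrite /hecke_form (bigD1 w) //= [X in _ + X]big1 ?addr0 => [|u ne]; last first.
  by rewrite big1 // => v _; rewrite ffunE (negbTE ne) !mul0r.
rewrite (bigD1 (w^-1)%g) //= mulVg ffunE !eqxx mul1r mulr1 big1 ?addr0 // => v ne.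
by rewrite -[(v * w)%g == _](inj_eq (mulIg (w^-1)%g)) mulgK mul1g (negbTE ne) mulr0.
Qed.

Lemma wprod_ge (p : nat) (r : seq 'I_n.-1) (x : 'I_n) : all (fun i : 'I_n.-1 => (p <= i)%N) r ->
  if (x < p)%N then wprod r x = x else (p <= wprod r x)%N.
Proof.
elim: r x => [|i r IH] x; first by rewrite /wprod big_nil perm1; case: ltnP.
case/andP=> /= le_i al; rewrite wprod_cons permM; have := IH (sref i x) al.
have := val_sref i x => /= E.
case: (ltnP x p) => [lt_x|le_x].
  have -> : sref i x = x by apply: val_inj; rewrite /= E; case_ifs.
  by rewrite lt_x.
have /negbTE-> // : ~~ (sref i x < p)%N by rewrite E; case_ifs.
Qed.

Lemma heckeT_increasing (r : seq 'I_n.-1) : sorted ltn (map val r) ->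
  T (wprod r) = \prod_(i <- map val r) t i.
Proof.
elim: r => [|i r IH] /=; first by rewrite /wprod !big_nil heckeT1.
move=> sr; have al : all (fun j : 'I_n.-1 => (i < j)%N) r.
  by have := order_path_min ltn_trans sr; rewrite all_map.
rewrite wprod_cons big_cons -IH ?(path_sorted sr) // hgen_ord heckeT_upl //.
rewrite dlE -leqNgt; have := wprod_ge (sleft i) al; have := wprod_ge (sright i) al.
by rewrite /= ltnn ltnSn => le_r ->; apply: ltnW.
Qed.

End HeckeTrace.

(** * Monomial symmetric polynomials *)

Fixpoint exponents (m k : nat) : seq (seq nat) :=
  if m is m'.+1 then [seq a :: s | a <- iota 0 k.+1, s <- exponents m' (k - a)]
  else if k is 0%N then [:: [::]] else [::].

Lemma mem_exponents m k s : (s \in exponents m k) = (size s == m) && (sumn s == k).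
Proof.
elim: m k s => [|m IH] k s; first by case: k s => [|k] [|a s].
apply/allpairsPdep/andP => [[a [u [+ + ->]]]|[]].
  rewrite -[a \in _]/(a \in iota 0 k.+1) mem_iota IH => ? /andP[/eqP su /eqP sk] /=.
  by rewrite su eqxx; split=> //; lia.
case: s => // a s /eqP[sz] /= /eqP sk; exists a, s; split=> //.
  by rewrite -[_ \in _]/(a \in iota 0 k.+1) mem_iota; lia.
by rewrite IH sz eqxx /=; lia.
Qed.

Lemma uniq_exponents m k : uniq (exponents m k).
Proof.
elim: m k => [|m IH] k; first by case: k.
apply: allpairs_uniq_dep => [|a _|]; [exact: iota_uniq | exact: IH |].
by move=> [a u] [b v] _ _ [-> ->].
Qed.

Section JucysMurphyPowers.
Variables (R : comNzRingType) (H : algType R) (t : nat -> H).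

Fixpoint jm_pow (s : seq nat) : H :=
  if s is a :: s' then jm_pow s' * jm t (size s') ^+ a else 1.

Lemma jm_eval_exponents m k (Q : seq nat -> R) :
  jm_eval t m k Q = \sum_(s <- exponents m k) Q s *: jm_pow s.
Proof.
elim: m k Q => [|m IH] k Q.
  by case: k => [|k]; rewrite /jm_eval /= ?big_nil ?big_seq1.
rewrite jm_evalS big_allpairs_dep -[iota 0 k.+1]/(index_iota 0 k.+1) big_mkord.
apply: eq_bigr => a _; rewrite IH mulr_suml big_seq [RHS]big_seq.
apply: eq_bigr => s; rewrite mem_exponents => /andP[/eqP <- _].
by rewrite scalerAl.
Qed.

Lemma jm_pow_rev s : jm_pow (rev s) = \prod_(i < size s) jm t i ^+ nth 0%N s i.
Proof.
elim/last_ind: s => [|s a IH]; first by rewrite big_ord0.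
rewrite rev_rcons size_rcons big_ord_recr /= IH size_rev nth_rcons ltnn eqxx.
by congr (_ * _); apply: eq_bigr => i _; rewrite nth_rcons ltn_ord.
Qed.

End JucysMurphyPowers.

Definition mono_coef (R : nzRingType) (mu s : seq nat) : R :=
  (perm_eq [seq x <- s | x != 0%N] mu)%:R.

Lemma mono_coef_zero_inv (R : comNzRingType) mu : zero_inv (mono_coef R mu).
Proof. by move=> u v; rewrite /mono_coef !filter_cat. Qed.

Lemma perm_sym_coef (R : comNzRingType) mu : sym_coef (mono_coef R mu).
Proof.
move=> u c d v; rewrite /mono_coef; congr (_%:R); congr nat_of_bool.
apply: (seq.permPl (perm_filter _ _)).
by rewrite perm_cat2l -[_ :: _ :: v]/([:: c] ++ [:: d] ++ v) perm_catCA.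
Qed.

Lemma perm_filter_nz (s mu : seq nat) : 0%N \notin mu -> (size mu <= size s)%N ->
  perm_eq [seq x <- s | x != 0%N] mu = perm_eq s (mu ++ nseq (size s - size mu) 0%N).
Proof.
move=> mu0 le_mu; apply/idP/idP => [ps|/(perm_filter (fun x => x != 0%N))]; last first.
  have /all_filterP Emu : all (fun x => x != 0%N) mu.
    by apply/allP => x xmu; apply: contraNneq mu0 => <-.
  rewrite filter_cat Emu.
  by rewrite filter_nseq cats0.
rewrite -(perm_filterC (fun x => x != 0%N) s); apply: perm_cat => //.
have -> : (size s - size mu)%N = size (filter (predC (fun x => x != 0%N)) s).
  by rewrite -(perm_size ps) !size_filter -(count_predC (fun x => x != 0%N) s) addKn.
have /all_pred1P {1}-> // : all (pred1 0%N) (filter (predC (fun x => x != 0%N)) s).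
by apply/allP => x; rewrite mem_filter /= negbK => /andP[].
Qed.

Section Monomials.
Variable N : nat.
Local Notation n := N.+1.

Lemma monomial_jm_eval (mu : seq nat) : 0%N \notin mu -> (size mu <= n)%N ->
  monomial_jm n mu = jm_eval (@hgen N) n (sumn mu) (mono_coef Zxi mu).
Proof.
move=> mu0 le_mu; rewrite /monomial_jm /monomial_sym raddf_sum jm_eval_exponents.
under eq_bigr do rewrite /= mmapX.
pose P s := perm_eq [seq x <- s | x != 0%N] mu.
transitivity (\sum_(s <- exponents n (sumn mu) | P s) jm_pow (@hgen N) s); last first.
  rewrite [RHS](bigID P) /= [X in _ + X]big1 ?addr0 => [|s /negbTE ns]; last first.
    by rewrite /mono_coef -/(P s) ns scale0r.
  by apply: eq_bigr => s Ps; rewrite /mono_coef -/(P s) Ps scale1r.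
rewrite -[RHS]big_filter; set L := undup _.
(* Exponent sequences list the last strand first, multinomials the first variable first; hence the
   reversal. *)
transitivity (\sum_(s <- [seq rev (val (val m)) | m : 'X_{1..n} <- L]) jm_pow (@hgen N) s).
  rewrite [RHS]big_map; apply: eq_bigr => m _; rewrite jm_pow_rev size_tuple.
  apply: eq_bigr => i _; rewrite (jm_jucys_murphy (ltn_ord i)).
  by congr (jucys_murphy _ ^+ _); [apply: val_inj | rewrite (mnm_nth 0%N)].
apply: perm_big; apply: uniq_perm.
- rewrite map_inj_uniq ?undup_uniq // => m m' /(can_inj revK) /val_inj/val_inj //.
- exact/filter_uniq/uniq_exponents.
move=> s; rewrite mem_filter mem_exponents /P.
pose mu' : n.-tuple nat :=
  tcast (subnKC le_mu) (cat_tuple (in_tuple mu) (nseq_tuple (n - size mu) 0%N)).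
have val_mu' : val mu' = mu ++ nseq (n - size mu) 0%N by rewrite /= val_tcast.
have nth_mu' (i : 'I_n) : tnth mu' i = nth 0%N mu i.
  rewrite (tnth_nth 0%N) val_mu' nth_cat; case: ltnP => // le_i.
  by rewrite nth_nseq [nth _ mu _]nth_default //; case: ifP.
apply/mapP/idP.
  case=> m; rewrite mem_undup => /mapP[sigma _ ->] ->.
  set m' := [multinom _ | _ < _].
  have szm : size (rev (val (val m'))) = n by rewrite size_rev size_tuple.
  have pm : perm_eq (rev (val (val m'))) mu'.
    rewrite perm_rev; apply/tuple_permP; exists (sigma^-1)%g.
    apply: (congr1 (@tval n nat)); apply: eq_from_tnth => i.
    by rewrite !tnth_mktuple nth_mu'.
  rewrite szm eqxx perm_filter_nz ?szm // -val_mu' pm /=.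
  by rewrite (perm_sumn pm) val_mu' sumn_cat sumn_nseq addn0.
case/and3P=> ps /eqP szs _; rewrite perm_filter_nz ?szs // -val_mu' in ps.
have /tuple_permP[p Ep] : perm_eq (rev s) mu' by rewrite perm_rev.
exists [multinom nth 0%N mu ((p^-1^-1)%g i) | i < n].
  by rewrite mem_undup; apply/mapP; exists (p^-1)%g; rewrite ?mem_enum.
rewrite -[LHS]revK Ep; congr rev; apply: (congr1 (@tval n nat)); apply: eq_from_tnth => i.
by rewrite !tnth_mktuple invgK nth_mu'.
Qed.

End Monomials.

Definition block_shape (c : seq nat) : seq nat := [seq x <- map predn c | x != 0%N].

(** Blocks of one strand act as the identity. This makes the leading pairings independent of n. *)
Lemma block_value_shape (R : comNzRingType) (x : R) (Q : seq nat -> R) c :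
  block_value x Q c = block_value x Q (map succn (block_shape c)).
Proof. by elim: c Q => [|[|[|a]] c IH] Q //=; rewrite IH. Qed.

Lemma sumn_block_shape c : sumn (block_shape c) = block_weight c.
Proof. by rewrite /block_shape /block_weight; elim: (map _ _) => [|[|a] s IH] //=; rewrite IH. Qed.

(** * Block values as traces *)

Section BlockOrder.
Variable N : nat.
Local Notation n := N.+1.
Local Notation t := (@hgen N).

Lemma hecke_jm_value c (Q : seq nat -> Zxi) : 0%N \notin c -> sumn c = n ->
  zero_inv Q -> htau (jm_eval t n (block_weight c) Q * block_elt t c) = block_value xi Q c.
Proof.
move=> c0 sc zQ.
have := tau_jm_eval_blocks (@hgen_sq N) (@hgenC N) (@hgen_braid N) (@htauC N)
  (@htau1 N) (@htau_gal N) c0 _ zQ.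
by rewrite sc; apply.
Qed.

Lemma hecke_jm_low c k (Q : seq nat -> Zxi) : 0%N \notin c -> sumn c = n ->
  (k < block_weight c)%N -> htau (jm_eval t n k Q * block_elt t c) = 0.
Proof.
move=> c0 sc lt_k.
have := tau_jm_eval_low (@hgen_sq N) (@hgenC N) (@hgen_braid N) (@htauC N)
  (@htau_gal N) Q c0 _ lt_k.
by rewrite sc; apply.
Qed.

Definition htau_mul (z h : hecke n) : Zxi := htau (z * h).

Lemma htau_mul_linear z : scalar (htau_mul z).
Proof. by move=> k a b; rewrite /htau_mul mulrDr -scalerAr linearP. Qed.

HB.instance Definition _ z :=
  GRing.isLinear.Build Zxi (hecke n) Zxi *%R (htau_mul z) (htau_mul_linear z).

Lemma htau_mul_trace z : hecke_centre z -> forall a b, htau_mul z (a * b) = htau_mul z (b * a).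
Proof. by move=> cz a b; rewrite /htau_mul mulrA htauC mulrA -cz mulrA. Qed.

Lemma jm_eval_centre k (Q : seq nat -> Zxi) : sym_coef Q -> hecke_centre (jm_eval t n k Q).
Proof.
move=> sQ h.
exact: (jm_eval_comm (@hgen_sq N) (@hgenC N) (@hgen_braid N) k sQ (gal_hecke h)).
Qed.

Lemma centre_block_perm z c c' : hecke_centre z -> sumn c = n -> perm_eq c c' ->
  htau (z * block_elt t c) = htau (z * block_elt t c').
Proof.
move=> cz sc pc.
by apply: (trace_block_perm (@hgen_sq N) (@hgenC N) (@hgen_braid N)
  (phi := htau_mul z) (htau_mul_trace cz) _ pc); rewrite sc.
Qed.

Lemma centre_eq0 z : hecke_centre z ->
  (forall c, 0%N \notin c -> sumn c = n -> htau (z * block_elt t c) = 0) -> z = 0.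
Proof.
move=> cz z0; apply/ffunP => w; rewrite ffunE -[w]invgK -htau_heckeT -cz.
exact: (trace_eq0_blocks (@hgen_sq N) (@hgenC N) (@hgen_braid N)
  (phi := htau_mul z) (htau_mul_trace cz) z0 (gal_hecke _)).
Qed.

End BlockOrder.

(** A combinatorial identity obtained from the Hecke algebra on [sumn c] strands: there the value is
    the pairing of a central element with an increasing element, and such a pairing ignores the
    order of the blocks. *)
Lemma block_value_perm (Q : seq nat -> Zxi) c c' : sym_coef Q -> zero_inv Q ->
  0%N \notin c -> perm_eq c c' -> block_value xi Q c = block_value xi Q c'.
Proof.
move=> sQ zQ c0 pc; case Ec : (sumn c) => [|N].
  by case: c c0 Ec pc => [|[|a] c] //= _ _ pc; rewrite perm_sym in pc; rewrite (perm_nilP pc).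
have Ec' : sumn c' = N.+1 by rewrite -(perm_sumn pc).
have c0' : 0%N \notin c' by rewrite -(perm_mem pc).
have Ew : block_weight c' = block_weight c by apply/esym/perm_sumn/perm_map.
rewrite -!(@hecke_jm_value N) // Ew.
exact/centre_block_perm/pc/Ec/jm_eval_centre.
Qed.

(** * Invertibility of M^(k) *)

Section Matrix.
Variable k : nat.
Implicit Types la mu nu : intpartn k.

Lemma zero_notin_intpartn la : 0%N \notin (la : seq nat).
Proof. by case: la => la /= /andP[/andP[]]. Qed.

Lemma sumn_intpartn la : sumn la = k.
Proof. by case: la => la /= /andP[_ /eqP]. Qed.

Lemma size_intpartn la : (size la <= k)%N.
Proof. by have [] := partition_bounds la. Qed.

Lemma perm_intpartn la mu : perm_eq la mu -> la = mu.
Proof.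
case: la mu => [la /= hla] [mu /= hmu] /= pm; apply: val_inj => /=.
have /andP[/andP[sla _] _] := hla; have /andP[/andP[smu _] _] := hmu.
apply: sorted_eq sla smu pm; first by move=> x y z /= ? ?; lia.
by move=> x y; lia.
Qed.

Lemma block_shape_intpartn la : block_shape (map succn la) = la.
Proof.
rewrite /block_shape -map_comp map_id_in //; apply/all_filterP/allP => x xla.
by apply: contraNneq (zero_notin_intpartn la) => <-.
Qed.

Lemma exists_intpartn s : 0%N \notin s -> sumn s = k -> exists la, perm_eq s la.
Proof.
move=> s0 sk; have hs : is_partition (sort geq s) && (sumn (sort geq s) == k).
  rewrite /is_partition mem_sort s0 (perm_sumn (_ : perm_eq _ s)) ?perm_sort // sk eqxx !andbT.
  by apply: sort_sorted => x y; lia.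
by exists (IntPartn hs); rewrite /= perm_sym perm_sort.
Qed.

(** The entries of M^(k), free of the choice of n' and of the increasing elements; see
    [form_increasing]. *)
Definition value_mx la mu : Zxi := block_value xi (mono_coef Zxi mu) (map succn la).

Lemma block_value_intpartn c la mu : perm_eq (block_shape c) la ->
  block_value xi (mono_coef Zxi mu) c = value_mx la mu.
Proof.
move=> pc; rewrite block_value_shape /value_mx.
apply: block_value_perm; rewrite ?perm_map //; [exact: perm_sym_coef | exact: mono_coef_zero_inv |].
by apply/mapP => -[].
Qed.

Lemma mono_coef_intpartn nu mu : mono_coef Zxi mu nu = (nu == mu)%:R.
Proof.
rewrite /mono_coef; have := block_shape_intpartn nu.
rewrite /block_shape -map_comp map_id_in // => ->; congr (_%:R); congr nat_of_bool.
by apply/idP/eqP => [/perm_intpartn | ->].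
Qed.

(** Row nu expands the evaluation at nu in block values. On monomial functions the evaluation is a
    Kronecker delta and block values depend only on the shape, so the coefficients are added up
    shape by shape. *)
Lemma value_mx_linv : exists L : intpartn k -> intpartn k -> Zxi,
  forall nu mu, \sum_la L nu la * value_mx la mu = (nu == mu)%:R.
Proof.
suff Lnu nu : exists L : intpartn k -> Zxi,
    forall mu, \sum_la L la * value_mx la mu = (nu == mu)%:R.
  by have [L E] := fin_all_exists Lnu; exists L.
have [/(_ nu (sumn_intpartn nu)) [l al E] _] := spanned_values xi k.
exists (fun la => \sum_(p <- l | perm_eq (block_shape p.2) la) p.1) => mu.
rewrite -mono_coef_intpartn (E _ (mono_coef_zero_inv _ _)).
under eq_bigr do rewrite big_mkcond mulr_suml.
rewrite exchange_big big_seq [RHS]big_seq; apply: eq_bigr => p /(allP al) /andP[p0 /eqP pk].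
have [||la pla] := @exists_intpartn (block_shape p.2); rewrite ?sumn_block_shape //.
  by rewrite mem_filter eqxx.
rewrite (bigD1 la) //= pla (block_value_intpartn _ pla) big1 ?addr0 // => la' ne.
rewrite ifN ?mul0r //; apply: contraNN ne => pla'; apply/eqP/perm_intpartn.
by rewrite -(permPl pla').
Qed.

End Matrix.

Section IncreasingMatrix.
Variables (k n : nat) (w : intpartn k -> 'S_n).
Hypothesis le_n : (0 < k)%N -> (2 * k <= n)%N.
Implicit Types la mu nu : intpartn k.
Hypothesis shape_w : forall la, (0 < k)%N -> increasing_of_shape la (w la).

Lemma form_increasing la mu : (0 < k)%N ->
  hecke_form (heckeT (w la)) (monomial_jm n mu) = value_mx la mu.
Proof.
move=> k_gt0; have le_k := le_n k_gt0; have [r [sr Ew Er]] := shape_w la k_gt0.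
have le_mu := size_intpartn mu.
case: n w le_k r sr Ew Er => [|N] w' le_k r sr Ew Er; first by lia.
have alr : all (gtn N) (map val r) by rewrite all_map; apply/allP => i _; apply: (ltn_ord i).
have [c [c0 sc pc Ec]] := sorted_word_blocks (@hgen N) sr alr.
rewrite Er in pc; have wc : block_weight c = k.
  by rewrite -sumn_block_shape /block_shape -(perm_sumn pc) sumn_intpartn.
rewrite Ew hecke_form_heckeT -htau_heckeT heckeT_increasing // -Ec htauC.
rewrite monomial_jm_eval ?zero_notin_intpartn //; last by lia.
rewrite sumn_intpartn -{1}wc hecke_jm_value //; last exact: mono_coef_zero_inv.
by apply: block_value_intpartn; rewrite perm_sym.
Qed.

Lemma matM_value_mx :
  matM w = \matrix_(i, j) value_mx (enum_val i : intpartn k) (enum_val j : intpartn k).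
Proof.
apply/matrixP => i j; rewrite !mxE; case: eqP => [k0|/eqP k0]; last first.
  by rewrite form_increasing // lt0n.
have E la : (la : seq nat) = [::].
  by have := size_intpartn la; rewrite {2}k0; case: (la : seq nat).
have -> : i = j by apply: enum_val_inj; apply: val_inj => /=; rewrite !E.
by rewrite eqxx /value_mx /mono_coef !E.
Qed.

Lemma sum_enum_val (F : intpartn k -> Zxi) :
  \sum_la F la = \sum_(i < #|{: intpartn k}|) F (enum_val i).
Proof. by rewrite (reindex (@enum_val _ {: intpartn k})) //; apply/onW_bij/enum_val_bij. Qed.

Lemma value_matN la nu : \sum_mu value_mx la mu * matN w mu nu = (la == nu)%:R.
Proof.
(* A one-sided inverse of a square matrix over a commutative ring is two-sided. Without a proof that
   the matrix is a unit, [invmx] could be its default value. *)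
have [L EL] := value_mx_linv k.
pose ML : 'M_#|{: intpartn k}| := \matrix_(i, j) L (enum_val i) (enum_val j).
have uM : matM w \in unitmx.
  apply: (proj2 (@mulmx1_unit _ _ ML _ _)); rewrite matM_value_mx.
  apply/matrixP => i j; rewrite !mxE -(inj_eq enum_val_inj) -EL.
  by rewrite sum_enum_val; apply: eq_bigr => x _; rewrite !mxE.
have := mulmxV uM => /matrixP/(_ (enum_rank la) (enum_rank nu)).
rewrite !mxE (inj_eq enum_rank_inj) => <-.
rewrite sum_enum_val; apply: eq_bigr => x _.
by rewrite /matN enum_valK matM_value_mx !mxE enum_rankK.
Qed.

End IncreasingMatrix.

(** * The basis of the centre *)

Section TriangularBasis.
Variables (R : nzRingType) (V : lmodType R) (Z : V -> Prop).
Variables (I : finType) (deg : I -> nat) (b : I -> V) (phi : I -> {scalar V}).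
Hypothesis Zb : forall i, Z (b i).
Hypothesis ZB : forall u v (c : R), Z u -> Z v -> Z (u - c *: v).
Hypothesis Zphi : forall v, Z v -> (forall i, phi i v = 0) -> v = 0.
Hypothesis phi_eq : forall i j, deg i = deg j -> phi i (b j) = (i == j)%:R.
Hypothesis phi_lt : forall i j, (deg j < deg i)%N -> phi i (b j) = 0.

(** No rank is counted. Coefficients are determined degree by degree from the top, and once all
    functionals vanish on the remainder, separation makes it zero. *)
Lemma triangular_basis : is_basis_of Z b.
Proof.
pose comb (c : I -> R) := \sum_i c i *: b i.
have phi_comb i c : (forall j, (deg i < deg j)%N -> c j = 0) -> phi i (comb c) = c i.
  move=> c0; rewrite linear_sum (bigD1 i) //= big1 ?addr0 => [|j ne].
    by rewrite linearZ /= phi_eq // eqxx mulr1.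
  rewrite linearZ /=; case: (ltngtP (deg i) (deg j)) => [/c0->|/phi_lt->|/phi_eq->].
  - by rewrite mul0r.
  - by rewrite mulr0.
  - by rewrite eq_sym (negbTE ne) mulr0.
have ltM i : (deg i < (\max_i deg i).+1)%N by rewrite ltnS leq_bigmax.
split=> // [v Zv|c c0 i]; last first.
  suff key m j : (m <= deg j)%N -> c j = 0 by apply: (key 0%N).
  have [d] := ubnP ((\max_i deg i).+1 - m)%N.
  elim: d m j => [|d IH] m j //; move=> lt_d le_m.
  rewrite -(phi_comb j c) ?[comb c]c0 ?linear0 // => l lt_l.
  by apply: (IH m.+1); [have := ltM l; lia | lia].
suff key m : exists c, Z (v - comb c) /\
    forall i, (m <= deg i)%N -> phi i (v - comb c) = 0.
  have [c [Zc c0]] := key 0%N; exists c; apply/eqP; rewrite -subr_eq0; apply/eqP.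
  by apply: Zphi => // i; apply: c0.
have ZD u c : Z u -> Z (u - comb c).
  rewrite /comb; elim/big_rec: _ u => [u|i x _ IH u Zu]; first by rewrite subr0.
  by rewrite opprD addrA; apply/IH/ZB.
have [d] := ubnP ((\max_i deg i).+1 - m)%N.
elim: d m => [|d IH] m // lt_d.
have [le_m|lt_m] := leqP m (\max_i deg i); last first.
  exists (fun=> 0); split; first exact: ZD.
  by move=> i le_m; have := ltM i; lia.
have [|c [Zc c0]] := IH m.+1; first by lia.
(* A correction supported in degree m is invisible to the functionals of higher degree, and those of
   degree m read off its coefficients. *)
pose e i := if deg i == m then phi i (v - comb c) else 0.
exists (fun i => c i + e i).
have -> : v - comb (fun i => c i + e i) = v - comb c - comb e.
  rewrite -addrA -opprD; congr (_ - _); rewrite -big_split.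
  by apply: eq_bigr => i _; rewrite scalerDl.
split=> [|i le_i]; first exact: ZD.
rewrite linearB /= phi_comb /e => [|j lt_j].
  by case: eqP => [_|/eqP ne]; rewrite ?subrr // subr0; apply: c0; lia.
by rewrite ifN //; lia.
Qed.

End TriangularBasis.

Section CentreBasis.
Variable N : nat.
Local Notation n := N.+1.
Local Notation t := (@hgen N).

(** A part a needs a block of a + 1 strands; the strands left over form blocks of size one. *)
Definition partition_blocks (la : seq nat) : seq nat :=
  map succn la ++ nseq (n - (sumn la + size la)) 1%N.

Lemma partition_blocks_pos la : 0%N \notin partition_blocks la.
Proof.
by rewrite mem_cat mem_nseq andbF orbF; apply/mapP => -[].
Qed.

Lemma sumn_map_succn s : sumn (map succn s) = (sumn s + size s)%N.
Proof. by elim: s => //= a s ->; lia. Qed.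

Lemma sumn_partition_blocks la : (sumn la + size la <= n)%N ->
  sumn (partition_blocks la) = n.
Proof. by move=> le_n; rewrite sumn_cat sumn_map_succn sumn_nseq mul1n subnKC. Qed.

Lemma block_shape_partition_blocks k (la : intpartn k) :
  block_shape (partition_blocks la) = la.
Proof.
rewrite /block_shape /partition_blocks map_cat filter_cat -/(block_shape _).
by rewrite block_shape_intpartn map_nseq filter_nseq cats0.
Qed.

Definition block_coef (la : seq nat) (z : hecke n) : Zxi :=
  htau (z * block_elt t (partition_blocks la)).

Lemma block_coef_linear la : scalar (block_coef la).
Proof. by move=> k a b; rewrite /block_coef mulrDl -scalerAl linearP. Qed.

HB.instance Definition _ la :=
  GRing.isLinear.Build Zxi (hecke n) Zxi *%R (block_coef la) (block_coef_linear la).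

Lemma block_coef_eq k (la mu : intpartn k) : (k + size la <= n)%N ->
  block_coef la (monomial_jm n mu) = value_mx la mu.
Proof.
move=> le_n; have le_mu := size_intpartn mu.
rewrite /block_coef monomial_jm_eval ?zero_notin_intpartn //; last by lia.
have sh := block_shape_partition_blocks la.
have <- : block_weight (partition_blocks la) = sumn mu.
  by rewrite -sumn_block_shape sh !sumn_intpartn.
rewrite hecke_jm_value ?partition_blocks_pos ?sumn_partition_blocks ?sumn_intpartn //.
  by apply: block_value_intpartn; rewrite sh.
exact: mono_coef_zero_inv.
Qed.

Lemma block_coef_lt k l (la : intpartn k) (mu : intpartn l) : (k + size la <= n)%N ->
  (l < k)%N -> block_coef la (monomial_jm n mu) = 0.
Proof.
move=> le_n lt_l; have le_mu := size_intpartn mu.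
rewrite /block_coef monomial_jm_eval ?zero_notin_intpartn //; last by lia.
apply: hecke_jm_low; rewrite ?partition_blocks_pos ?sumn_partition_blocks ?sumn_intpartn //.
by rewrite -sumn_block_shape block_shape_partition_blocks sumn_intpartn.
Qed.

Lemma monomial_jm_centre (mu : seq nat) : 0%N \notin mu -> (size mu <= n)%N ->
  hecke_centre (monomial_jm n mu).
Proof.
by move=> mu0 le_mu; rewrite monomial_jm_eval //; apply/jm_eval_centre/perm_sym_coef.
Qed.

Lemma hecke_centre_sub (u v : hecke n) (c : Zxi) :
  hecke_centre u -> hecke_centre v -> hecke_centre (u - c *: v).
Proof. by move=> cu cv h; rewrite mulrBl mulrBr cu -scalerAl cv -scalerAr. Qed.

Lemma calM_centre k (c : intpartn k -> intpartn k -> Zxi) la : (k <= n)%N ->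
  hecke_centre (calM n c la).
Proof.
move=> le_k h; rewrite /calM mulr_suml mulr_sumr; apply: eq_bigr => mu _.
rewrite -scalerAl monomial_jm_centre ?scalerAr ?zero_notin_intpartn //.
exact: leq_trans (size_intpartn mu) le_k.
Qed.

Lemma perm_partition_blocks c : 0%N \notin c -> exists2 j,
  sumn c = (block_weight c + size (block_shape c) + j)%N &
  perm_eq c (map succn (block_shape c) ++ nseq j 1%N).
Proof.
elim: c => [|a c IH]; first by exists 0%N.
rewrite inE negb_or => /andP[a_gt0 /IH[j Ej Pj]].
case: a a_gt0 => [|[|a]] // _; rewrite /block_weight /= -/(block_weight c) Ej.
  exists j.+1; first by rewrite /block_shape /= -/(block_shape c); lia.
  rewrite /block_shape /= -/(block_shape c) -[1%N :: nseq j _]/([:: 1%N] ++ nseq j 1%N).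
  by rewrite perm_sym perm_catCA perm_cons perm_sym.
exists j; first by rewrite /block_shape /= -/(block_shape c); lia.
by rewrite /block_shape /= perm_cons.
Qed.

(** A division of n strands into blocks is, up to order, the standard one of its shape. Counting
    strands gives the bound |la| + l(la) <= n, which is where admissibility comes from. *)
Lemma centre_separated z : hecke_centre z ->
  (forall la : admissible n, block_coef (tagged (val la)) z = 0) -> z = 0.
Proof.
move=> cz z0; apply: centre_eq0 => // c c0 sc.
have [||la pc] := @exists_intpartn (block_weight c) (block_shape c).
- by rewrite mem_filter eqxx.
- exact: sumn_block_shape.
have [j Ej Pj] := perm_partition_blocks c0.
have le_c : (block_weight c + size la <= n)%N.
  by rewrite -sc Ej -(perm_size pc) leq_addr.
have lt_k : (block_weight c < n.+1)%N by rewrite ltnS (leq_trans _ le_c) ?leq_addr.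
pose La : {k : 'I_n.+1 & intpartn k} :=
  @Tagged _ (Ordinal lt_k) (fun k : 'I_n.+1 => intpartn k) la.
have := z0 (Sub La le_c); rewrite SubK /block_coef => <-; apply: centre_block_perm => //.
apply: perm_trans Pj _; rewrite /partition_blocks /= perm_cat ?perm_map //.
by rewrite sumn_intpartn -(perm_size pc) -sc Ej addKn.
Qed.

End CentreBasis.

(* For each k >= 1, n' k is an arbitrary integer >= 2k and w k la an arbitrary
   increasing element of shape la in S_(n' k); they serve to define N^(k). *)
Theorem theorem4p1 (n : nat) (hn : (1 <= n)%N)
    (n' : nat -> nat)
    (w : forall k : nat, intpartn k -> 'S_(n' k))
    (hn' : forall k : nat, (1 <= k)%N -> (2 * k <= n' k)%N)
    (hw : forall (k : nat) (la : intpartn k), (1 <= k)%N ->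
            increasing_of_shape la (w k la)) :
  is_basis_of (@hecke_centre n)
    (fun la : admissible n =>
       calM n (matN (w (tag (val la)))) (tagged (val la))).
Proof.
case: n hn => // N _; pose deg (la : admissible N.+1) : nat := tag (val la).
apply: (triangular_basis (deg := deg)
  (phi := fun la : admissible N.+1 => block_coef (tagged (val la)))).
- by move=> la; apply: calM_centre; rewrite -ltnS; apply: ltn_ord.
- exact: hecke_centre_sub.
- exact: centre_separated.
- move=> [[k la] le_la] [[l mu] le_mu]; rewrite /deg /= => /val_inj E.
  case: _ / E mu le_mu => mu le_mu.
  rewrite /calM linear_sum.
  (* Within one degree the pairings form the product of M^(k) with its inverse, although n may be
     smaller than 2k. *)
  transitivity (\sum_nu value_mx la nu * matN (w k) nu mu).
    by apply: eq_bigr => nu _; rewrite linearZ /= block_coef_eq // mulrC.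
  rewrite (value_matN (hn' k) (hw k)); congr (_%:R); congr nat_of_bool.
  by rewrite -[RHS]val_eqE /=; apply/esym/eq_Tagged.
move=> [[k la] le_la] [[l mu] le_mu]; rewrite /deg /= => lt_l.
rewrite /calM linear_sum big1 // => nu _.
by rewrite linearZ /= block_coef_lt ?mulr0.
Qed.
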